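(* Over $\mathsf{ACA}_0$, the following are equivalent: (1) $\mathsf{ATR}_0$; (2) every scattered partial order with no infinite antichains has countably many initial intervals; (3) every scattered linear order has countably many initial intervals.
   Context: Reverse mathematics in second-order arithmetic; $\mathsf{ACA}_0$, $\mathsf{ATR}_0$ are the usual subsystems. A partial order $(P,\preceq)$ has $P\subseteq\mathbb{N}$. An antichain is a set of pairwise incomparable elements. An initial interval of $P$ is $I\subseteq P$ with $x\preceq y\in I\Rightarrow x\in I$. $P$ has countably many initial intervals if there is a sequence $\{I_n:n\in\mathbb{N}\}$ (coded by one set) such that every initial interval of $P$ equals some $I_n$. An embedding $f:Q\to P$ satisfies $x\preceq_Q y\iff f(x)\preceq_P f(y)$; $P$ is scattered if there is no embedding of $(\mathbb{Q},\le)$ into $P$. *)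

(* Defs.v *)
(* Only the Rocq prelude is used. *)

Set Implicit Arguments.
Unset Strict Implicit.

(* Structures for the language of second-order arithmetic, with Henkin
   semantics: [num] may be nonstandard and set quantifiers range over the
   family [sets] of subsets of [num] only. *)
Record L2_structure : Type := L2Structure {
  num  : Type;
  zero : num;
  one  : num;
  add  : num -> num -> num;
  mul  : num -> num -> num;
  lt   : num -> num -> Prop;
  sets : (num -> Prop) -> Prop
}.

Arguments zero {_}.
Arguments one {_}.
Arguments add {_} _ _.
Arguments mul {_} _ _.
Arguments lt {_} _ _.
Arguments sets {_} _.

Declare Scope L2_scope.
Delimit Scope L2_scope with L2.
Local Open Scope L2_scope.
Notation "0" := zero : L2_scope.
Notation "1" := one : L2_scope.
Notation "x + y" := (add x y) : L2_scope.
Notation "x * y" := (mul x y) : L2_scope.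
Notation "x < y" := (lt x y) : L2_scope.
Notation "x <= y" := (x < y \/ x = y) : L2_scope.

Notation "'allset' X 'in' M , p" := (forall X : num M -> Prop, sets X -> p)
  (at level 10, X name, M at level 9, p at level 200).
Notation "'exset' X 'in' M , p" := (exists X : num M -> Prop, sets X /\ p)
  (at level 10, X name, M at level 9, p at level 200).

(** * Arithmetical formulas: no set quantifiers, free set variables allowed *)

(* Number variables are de Bruijn indices; set variables are never bound. *)
Inductive term : Type :=
  | tvar  (i : nat)
  | tzero
  | tone
  | tadd  (s t : term)
  | tmul  (s t : term).

Inductive arith : Type :=
  | feq  (s t : term)
  | flt  (s t : term)
  | fmem (t : term) (k : nat)
  | fnot (p : arith)
  | fand (p q : arith)
  | f_or (p q : arith)
  | fimp (p q : arith)
  | fall (p : arith)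
  | fex  (p : arith).

Definition scons {A : Type} (a : A) (e : nat -> A) (i : nat) : A :=
  match i with O => a | S j => e j end.

Fixpoint eval {M : L2_structure} (e : nat -> num M) (t : term) : num M :=
  match t with
  | tvar i   => e i
  | tzero    => 0
  | tone     => 1
  | tadd s t => eval e s + eval e t
  | tmul s t => eval e s * eval e t
  end.

Fixpoint sat {M : L2_structure} (e : nat -> num M) (E : nat -> num M -> Prop)
    (p : arith) : Prop :=
  match p with
  | feq s t  => eval e s = eval e t
  | flt s t  => eval e s < eval e t
  | fmem t k => E k (eval e t)
  | fnot p   => ~ sat e E p
  | fand p q => sat e E p /\ sat e E q
  | f_or p q => sat e E p \/ sat e E q
  | fimp p q => sat e E p -> sat e E q
  | fall p   => forall a : num M, sat (scons a e) E p
  | fex p    => exists a : num M, sat (scons a e) E p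
  end.

(** * [ACA0] *)

Record basic_axioms (M : L2_structure) : Prop := BasicAxioms {
  succ_neq0 : forall n : num M, n + 1 <> 0;
  succ_inj  : forall m n : num M, m + 1 = n + 1 -> m = n;
  addn0     : forall m : num M, m + 0 = m;
  addnS     : forall m n : num M, m + (n + 1) = (m + n) + 1;
  muln0     : forall m : num M, m * 0 = 0;
  mulnS     : forall m n : num M, m * (n + 1) = m * n + m;
  ltn0      : forall m : num M, ~ m < 0;
  ltnS      : forall m n : num M, m < n + 1 <-> m < n \/ m = n
}.

Definition induction_axiom (M : L2_structure) : Prop :=
  allset X in M,
    X 0 -> (forall n, X n -> X (n + 1)) -> forall n, X n.

(* Comprehension is over number variable 0; [e] and [E] supply the number and
   set parameters. *)
Definition arith_comprehension (M : L2_structure) : Prop :=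
  forall (p : arith) (e : nat -> num M) (E : nat -> num M -> Prop),
    (forall k, sets (E k)) ->
    exset X in M, forall n, X n <-> sat (scons n e) E p.

Record ACA0 (M : L2_structure) : Prop := MkACA0 {
  ACA0_basic : basic_axioms M;
  ACA0_ind   : induction_axiom M;
  ACA0_comp  : arith_comprehension M
}.

(** * Pairs, relations and functions coded by sets of numbers *)

Definition pair {M : L2_structure} (i j : num M) : num M :=
  (i + j) * (i + j) + i.

(* [coded L x y]: (x, y) belongs to the binary relation coded by [L]. *)
Definition coded {M : L2_structure} (L : num M -> Prop) (x y : num M) : Prop :=
  L (pair x y).

Definition subset_prod {M : L2_structure} (A B F : num M -> Prop) : Prop :=
  forall z, F z -> exists x y, z = pair x y /\ A x /\ B y.

Definition is_function {M : L2_structure} (A B F : num M -> Prop) : Prop :=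
  subset_prod A B F /\ forall x, A x -> exists! y, coded F x y.

(** * Orders *)

Record partial_order {M : L2_structure} (P L : num M -> Prop) : Prop :=
  PartialOrder {
    po_sub     : subset_prod P P L;
    po_refl    : forall x, P x -> coded L x x;
    po_antisym : forall x y, coded L x y -> coded L y x -> x = y;
    po_trans   : forall x y z, coded L x y -> coded L y z -> coded L x z
  }.

Definition linear_order {M : L2_structure} (P L : num M -> Prop) : Prop :=
  partial_order P L /\ forall x y, P x -> P y -> coded L x y \/ coded L y x.

Definition strict {M : L2_structure} (L : num M -> Prop) (x y : num M) : Prop :=
  coded L x y /\ ~ coded L y x.

(* No infinite descending sequence belongs to the structure. *)
Definition well_order {M : L2_structure} (P L : num M -> Prop) : Prop :=
  linear_order P L /\
  ~ exset F in M, is_function (fun _ => True) P F /\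
             forall n y y', coded F n y -> coded F (n + 1) y' -> strict L y' y.

(** * [ATR0] *)

(* Y^j = {(m, i) in Y | i < j in the order L}. *)
Definition below {M : L2_structure} (L Y : num M -> Prop) (j z : num M) : Prop :=
  exists m i, z = pair m i /\ strict L i j /\ Y z.

(* H_theta: Y = {(n, j) | j in W and theta(n, Y^j)}; in [p], which is theta, n is
   number variable 0 and Y^j is set variable 0. *)
Definition is_hierarchy {M : L2_structure} (p : arith)
    (e : nat -> num M) (E : nat -> num M -> Prop) (W L Y : num M -> Prop) : Prop :=
  forall z, Y z <->
    exists n j, z = pair n j /\ W j /\ sat (scons n e) (scons (below L Y j) E) p.

Definition arith_transfinite_recursion (M : L2_structure) : Prop :=
  forall (p : arith) (e : nat -> num M) (E : nat -> num M -> Prop),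
    (forall k, sets (E k)) ->
    allset W in M, allset L in M, well_order W L -> exset Y in M, is_hierarchy p e E W L Y.

Definition ATR0 (M : L2_structure) : Prop :=
  ACA0 M /\ arith_transfinite_recursion M.

(** * Rational numbers of the structure *)

(* ((a, b), c) with c > 0 represents the fraction (a - b) / c. *)
Definition fraction {M : L2_structure} (q a b c : num M) : Prop :=
  q = pair (pair a b) c /\ 0 < c.

Definition rat_le {M : L2_structure} (q r : num M) : Prop :=
  exists a b c a' b' c',
    fraction q a b c /\ fraction r a' b' c' /\
    a * c' + b' * c <= a' * c + b * c'.

(* A rational is the least code among the fractions with the same value. *)
Definition rational {M : L2_structure} (q : num M) : Prop :=
  (exists a b c, fraction q a b c) /\
  forall r, r < q -> ~ (rat_le q r /\ rat_le r q).

(** * Scattered orders, antichains and initial intervals *)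

Definition embedding {M : L2_structure}
    (A : num M -> Prop) (leA : num M -> num M -> Prop)
    (B : num M -> Prop) (leB : num M -> num M -> Prop) (F : num M -> Prop) : Prop :=
  is_function A B F /\
  forall x x' y y', coded F x y -> coded F x' y' -> (leA x x' <-> leB y y').

Definition scattered {M : L2_structure} (P L : num M -> Prop) : Prop :=
  ~ exset F in M, embedding rational rat_le P (coded L) F.

Definition antichain {M : L2_structure} (P L A : num M -> Prop) : Prop :=
  (forall x, A x -> P x) /\
  forall x y, A x -> A y -> x <> y -> ~ coded L x y /\ ~ coded L y x.

Definition infinite {M : L2_structure} (A : num M -> Prop) : Prop :=
  forall m, exists n, m < n /\ A n.

Definition no_infinite_antichain {M : L2_structure} (P L : num M -> Prop) : Prop :=
  ~ exset A in M, antichain P L A /\ infinite A.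

Definition initial_interval {M : L2_structure} (P L I : num M -> Prop) : Prop :=
  (forall x, I x -> P x) /\ forall x y, coded L x y -> I y -> I x.

(* The n-th set of the sequence coded by Z. *)
Definition slice {M : L2_structure} (Z : num M -> Prop) (n m : num M) : Prop :=
  coded Z m n.

Definition countably_many_initial_intervals {M : L2_structure}
    (P L : num M -> Prop) : Prop :=
  exset Z in M, allset I in M, initial_interval P L I ->
    exists n, forall x, I x <-> slice Z n x.

(* Main.v *)
(* From the scattered linear orders to transfinite recursion: the hierarchies along
   the initial segments of a well-order W are the unique solutions of arithmetical
   conditions; with Skolem functions added, they become the paths of a tree T in which
   two paths with the same first entry are equal. The Kleene-Brouwer order of such a
   tree is scattered: given p < r < r' < q with images in the cone of one node of
   length 1, the dense sets of images of [p, r] and of [r', q] both determine a path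
   above that node, so these paths agree and the image of r extends all initial
   segments of a path. A path is the leftmost path of T minus the set of nodes to its
   left, which is an initial interval, so an enumeration of the initial intervals
   yields an enumeration of all hierarchies, and the least j in W without a hierarchy
   is ruled out by arithmetical comprehension.

   From transfinite recursion to partial orders: a piece c of P is a set of points cut
   out by finitely many constraints (below x, above x, incomparable with x). A family
   of pieces is self-supporting if each member c has a point x such that the
   part of c incomparable with x, or both the part below x and the part above x,
   belong to the family. A self-supporting family containing P yields an infinite
   antichain or a copy of the rationals. If there is none, the tree of finite attempts
   at one has no path and its Kleene-Brouwer order is a well-order; recursion along it
   assigns ranks to the pieces, and P gets a rank since otherwise the attempts could
   be continued forever. By recursion on the rank one enumerates the initial
   intervals I of a ranked piece c: either some x not in I has a ranked part below it,
   or some x in I has a ranked part above it, and I is determined on the remaining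
   points by the ranked parts; or else I consists of the x whose part below is ranked. *)

From Stdlib Require Import Classical ClassicalEpsilon FunctionalExtensionality
  PropExtensionality Setoid Ring List Lia.
Require Import Defs.
Import ListNotations.

Set Implicit Arguments.
Unset Strict Implicit.

Lemma set_ext (A : Type) (X Y : A -> Prop) : (forall n, X n <-> Y n) -> X = Y.
Proof.
  intro h; apply functional_extensionality; intro n.
  apply propositional_extensionality; auto.
Qed.

(* [arith_comprehension] needs an assignment of sets to all set variables, so a
   structure without any set satisfies [ACA0] vacuously and is excluded here. *)
Class model (M : L2_structure) : Prop := Model {
  model_ACA0 : ACA0 M;
  model_set  : exists X : num M -> Prop, sets X
}.

(** * Definability *)

Section Definability.
Context {M : L2_structure} {hM : model M}.
Local Open Scope L2_scope.
Notation N := (num M).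
Notation env := (nat -> num M).

Fixpoint ren (f : nat -> nat) (p : arith) : arith :=
  match p with
  | feq s t => feq s t
  | flt s t => flt s t
  | fmem t k => fmem t (f k)
  | fnot p => fnot (ren f p)
  | fand p q => fand (ren f p) (ren f q)
  | f_or p q => f_or (ren f p) (ren f q)
  | fimp p q => fimp (ren f p) (ren f q)
  | fall p => fall (ren f p)
  | fex p => fex (ren f p)
  end.

Lemma sat_ren f p : forall (e : env) E,
  sat e E (ren f p) <-> sat e (fun k => E (f k)) p.
Proof.
  induction p; intros e E; simpl; try tauto.
  - now rewrite IHp.
  - now rewrite IHp1, IHp2.
  - now rewrite IHp1, IHp2.
  - now rewrite IHp1, IHp2.
  - split; intros h a; apply IHp, h.
  - split; intros [a h]; exists a; apply IHp, h.
Qed.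

(* In [phi X e] the set variable X ranges over the sets of the structure and e
   assigns the number variables; other set parameters are hidden in the formula. *)
Definition Def (phi : (N -> Prop) -> env -> Prop) : Prop :=
  exists p E, (forall k, sets (E k)) /\
    forall X e, sets X -> (sat e (scons X E) p <-> phi X e).

(** Functions are handled through their graphs, with the value in variable 0 and the parameters
    shifted by one. This covers operators such as the least-number operator, which are not terms of
    the language; substituting such a function becomes an existential quantifier over its value. *)
Definition TDef (t : (N -> Prop) -> env -> N) : Prop :=
  Def (fun X e => e O = t X (fun i => e (S i))).

Lemma Def_iff (A B : (N -> Prop) -> env -> Prop) :
  (forall X e, sets X -> (A X e <-> B X e)) -> Def A -> Def B.
Proof.
  intros h (p & E & hE & hp); exists p, E; split; [exact hE|].
  intros X e hX; rewrite hp by exact hX; auto.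
Qed.

(** Interleaves two parameter families at even and odd places, so that two formulas with unrelated
    set parameters can be joined into one formula. *)
Definition mix (E F : nat -> N -> Prop) (k : nat) : N -> Prop :=
  if Nat.even k then E (Nat.div2 k) else F (Nat.div2 k).

Lemma mix_sets E F : (forall k, sets (E k)) -> (forall k, sets (F k)) ->
  forall k, sets (mix E F k).
Proof. intros hE hF k; unfold mix; destruct (Nat.even k); auto. Qed.

Lemma mix_l E F X :
  (fun k => scons X (mix E F) (match k with O => O | S k => S (2 * k) end)) = scons X E.
Proof.
  apply functional_extensionality; intros [|k]; [reflexivity|].
  cbn [scons]; unfold mix.
  rewrite PeanoNat.Nat.even_even, PeanoNat.Nat.div2_double; reflexivity.
Qed.

Lemma mix_r E F X :
  (fun k => scons X (mix E F) (match k with O => O | S k => S (S (2 * k)) end)) = scons X F.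
Proof.
  apply functional_extensionality; intros [|k]; [reflexivity|].
  cbn [scons]; unfold mix.
  replace (Nat.even (S (2 * k))) with false
    by (rewrite PeanoNat.Nat.even_succ, PeanoNat.Nat.odd_even; reflexivity).
  rewrite PeanoNat.Nat.div2_succ_double; reflexivity.
Qed.

Lemma Def_bin (c : arith -> arith -> arith) (C : Prop -> Prop -> Prop)
    (hc : forall e E p q, sat (M := M) e E (c p q) <-> C (sat e E p) (sat e E q))
    (A B : (N -> Prop) -> env -> Prop) :
  Def A -> Def B -> Def (fun X e => C (A X e) (B X e)).
Proof.
  intros (p & E & hE & hp) (q & F & hF & hq).
  (* Set variable 0 stays X in both formulas; variable k+1 of the first goes to 2k+1 and that of the
     second to 2k+2, as the interleaving demands. *)
  exists (c (ren (fun k => match k with O => O | S k => S (2 * k) end) p)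
            (ren (fun k => match k with O => O | S k => S (S (2 * k)) end) q)), (mix E F).
  split; [now apply mix_sets|].
  intros X e hX. rewrite hc.
  rewrite (propositional_extensionality _ _ (sat_ren _ p _ _)),
    (propositional_extensionality _ _ (sat_ren _ q _ _)), mix_l, mix_r.
  rewrite (propositional_extensionality _ _ (hp X e hX)),
    (propositional_extensionality _ _ (hq X e hX)).
  reflexivity.
Qed.

Lemma Def_and A B : Def A -> Def B -> Def (fun X e => A X e /\ B X e).
Proof. apply (@Def_bin fand and); simpl; tauto. Qed.
Lemma Def_or A B : Def A -> Def B -> Def (fun X e => A X e \/ B X e).
Proof. apply (@Def_bin f_or or); simpl; tauto. Qed.
Lemma Def_imp A B : Def A -> Def B -> Def (fun X e => A X e -> B X e).
Proof. apply (@Def_bin fimp (fun a b => a -> b)); simpl; tauto. Qed.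
Lemma Def_equiv A B : Def A -> Def B -> Def (fun X e => A X e <-> B X e).
Proof.
  apply (@Def_bin (fun p q => fand (fimp p q) (fimp q p)) iff); simpl; tauto.
Qed.
Lemma Def_not A : Def A -> Def (fun X e => ~ A X e).
Proof.
  intros (p & E & hE & hp); exists (fnot p), E; split; [exact hE|].
  intros X e hX; simpl; rewrite hp by exact hX; tauto.
Qed.
Lemma Def_all (A : (N -> Prop) -> env -> N -> Prop) :
  Def (fun X e => A X (fun i => e (S i)) (e O)) -> Def (fun X e => forall a, A X e a).
Proof.
  intros (p & E & hE & hp); exists (fall p), E; split; [exact hE|].
  intros X e hX; simpl; split; intros h a; apply (hp X (scons a e) hX), h.
Qed.
Lemma Def_ex (A : (N -> Prop) -> env -> N -> Prop) :
  Def (fun X e => A X (fun i => e (S i)) (e O)) -> Def (fun X e => exists a, A X e a).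
Proof.
  intros (p & E & hE & hp); exists (fex p), E; split; [exact hE|].
  intros X e hX; simpl; split; intros [a h]; exists a; apply (hp X (scons a e) hX), h.
Qed.

Lemma Def_formula p : Def (fun X e => sat e (fun _ => X) p).
Proof.
  destruct model_set as [X0 h0].
  (* All set variables are renamed to variable 0, which is X; [X0] fills the remaining places of the
     assignment. *)
  exists (ren (fun _ => O) p), (fun _ => X0); split; [auto|].
  intros X e hX; rewrite sat_ren; reflexivity.
Qed.

(** A proposition of the metatheory that does not mention the variables is decided by excluded
    middle and replaced by 0 = 0 or its negation. *)
Lemma Def_const (A : Prop) : Def (fun _ _ => A).
Proof.
  destruct (classic A) as [h|h].
  - apply (Def_iff (A := fun X e => sat e (fun _ => X) (feq tzero tzero)));
      [simpl; tauto | apply Def_formula].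
  - apply (Def_iff (A := fun X e => sat e (fun _ => X) (fnot (feq tzero tzero))));
      [simpl; tauto | apply Def_formula].
Qed.

Lemma Def_sets (phi : (N -> Prop) -> env -> N -> Prop) :
  Def (fun X e => phi X (fun i => e (S i)) (e O)) ->
  forall X e, sets X -> sets (phi X e).
Proof.
  intros (p & E & hE & hp) X e hX.
  destruct (@ACA0_comp M model_ACA0 p e (scons X E)) as (Y & hY & hYp).
  { intros [|k]; simpl; auto. }
  replace (phi X e) with Y; [exact hY|].
  apply set_ext; intro n; rewrite hYp. apply (hp X (scons n e) hX).
Qed.

Lemma comprehension (phi : N -> Prop) : Def (fun X e => phi (e O)) -> sets phi.
Proof.
  intro h; destruct model_set as [X0 h0].
  apply (Def_sets (phi := fun _ _ n => phi n) h (X := X0) (fun _ => 0) h0).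
Qed.

Lemma Def_var_mem (t : (N -> Prop) -> env -> N) : TDef t -> Def (fun X e => X (t X e)).
Proof.
  intro h.
  apply (Def_iff (A := fun X e => exists a, a = t X e /\ X a)).
  { intros X e _; split; [intros (a & -> & k); exact k | intro k; exists (t X e); auto]. }
  apply Def_ex, Def_and; [exact h|].
  apply (Def_formula (fmem (tvar O) O)).
Qed.

Lemma Def_mem (Y : N -> Prop) : sets Y -> Def (fun X e => Y (e O)).
Proof.
  intro hY; exists (fmem (tvar O) 1), (fun _ => Y); split; [auto|]; simpl; tauto.
Qed.

Lemma TDef_const (c : N) : TDef (fun _ _ => c).
Proof.
  destruct model_set as [X0 h0].
  assert (h : sets (fun n => n = c)).
  { destruct (@ACA0_comp M model_ACA0 (feq (tvar 0) (tvar 1)) (fun _ => c) (fun _ => X0))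
      as (Y & hY & hYp); [auto|].
    replace (fun n => n = c) with Y; [exact hY|].
    apply set_ext; intro n; rewrite hYp; simpl; tauto. }
  exact (Def_mem h).
Qed.

Lemma TDef_var i : TDef (fun _ e => e i).
Proof. exact (Def_formula (feq (tvar 0) (tvar (S i)))). Qed.

Lemma Def_subst1 (A : (N -> Prop) -> env -> N -> Prop) t :
  Def (fun X e => A X (fun i => e (S i)) (e O)) -> TDef t ->
  Def (fun X e => A X e (t X e)).
Proof.
  intros hA ht.
  apply (Def_iff (A := fun X e => exists a, a = t X e /\ A X e a)).
  { intros X e _; split; [intros (a & -> & k); exact k | intro k; exists (t X e); auto]. }
  apply Def_ex, Def_and; [exact ht | exact hA].
Qed.

Fixpoint subst_term (f : nat -> nat) (t : term) : term :=
  match t with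
  | tvar i => tvar (f i)
  | tzero => tzero
  | tone => tone
  | tadd s t => tadd (subst_term f s) (subst_term f t)
  | tmul s t => tmul (subst_term f s) (subst_term f t)
  end.

Definition up (f : nat -> nat) (i : nat) : nat :=
  match i with O => O | S i => S (f i) end.

Fixpoint vren (f : nat -> nat) (p : arith) : arith :=
  match p with
  | feq s t => feq (subst_term f s) (subst_term f t)
  | flt s t => flt (subst_term f s) (subst_term f t)
  | fmem t k => fmem (subst_term f t) k
  | fnot p => fnot (vren f p)
  | fand p q => fand (vren f p) (vren f q)
  | f_or p q => f_or (vren f p) (vren f q)
  | fimp p q => fimp (vren f p) (vren f q)
  | fall p => fall (vren (up f) p)
  | fex p => fex (vren (up f) p)
  end.

Lemma eval_subst f t (e : env) : eval e (subst_term f t) = eval (fun i => e (f i)) t.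
Proof. induction t; simpl; congruence. Qed.

Lemma scons_up a (e : env) f : (fun i => scons a e (up f i)) = scons a (fun i => e (f i)).
Proof. apply functional_extensionality; intros [|i]; reflexivity. Qed.

Lemma sat_vren p : forall f (e : env) E,
  sat e E (vren f p) <-> sat (fun i => e (f i)) E p.
Proof.
  induction p; intros f e E; simpl; rewrite ?eval_subst; try tauto.
  - now rewrite IHp.
  - now rewrite IHp1, IHp2.
  - now rewrite IHp1, IHp2.
  - now rewrite IHp1, IHp2.
  - split; intros h a; [rewrite <- scons_up; apply IHp, h
                       | apply IHp; rewrite scons_up; apply h].
  - split; intros [a h]; exists a; [rewrite <- scons_up; apply IHp, h
                       | apply IHp; rewrite scons_up; apply h].
Qed.

Lemma Def_ren (f : nat -> nat) A : Def A -> Def (fun X e => A X (fun i => e (f i))).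
Proof.
  intros (p & E & hE & hp); exists (vren f p), E; split; [exact hE|].
  intros X e hX; rewrite sat_vren; auto.
Qed.

Lemma TDef_ren (f : nat -> nat) t : TDef t -> TDef (fun X e => t X (fun i => e (f i))).
Proof. intro h; exact (Def_ren (up f) h). Qed.

Definition DR1 (R : N -> Prop) := Def (fun X e => R (e 0%nat)).
Definition DR2 (R : N -> N -> Prop) := Def (fun X e => R (e 0%nat) (e 1%nat)).
Definition DR3 (R : N -> N -> N -> Prop) :=
  Def (fun X e => R (e 0%nat) (e 1%nat) (e 2%nat)).
Definition DR4 (R : N -> N -> N -> N -> Prop) :=
  Def (fun X e => R (e 0%nat) (e 1%nat) (e 2%nat) (e 3%nat)).
Definition DF1 (f : N -> N) := TDef (fun X e => f (e 0%nat)).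
Definition DF2 (f : N -> N -> N) := TDef (fun X e => f (e 0%nat) (e 1%nat)).
Definition DF3 (f : N -> N -> N -> N) := TDef (fun X e => f (e 0%nat) (e 1%nat) (e 2%nat)).

Lemma Def_R1 R a : DR1 R -> TDef a -> Def (fun X e => R (a X e)).
Proof. exact (@Def_subst1 (fun _ _ x => R x) a). Qed.

Lemma Def_R2 R a b : DR2 R -> TDef a -> TDef b -> Def (fun X e => R (a X e) (b X e)).
Proof.
  intros h ha hb.
  apply (Def_subst1 (A := fun X e x => R x (b X e))); [|exact ha].
  apply (Def_subst1 (A := fun X e y => R (e 0%nat) y));
    [|exact (TDef_ren S hb)].
  exact (Def_ren (fun i => match i with 0 => 1 | 1 => 0 | i => i end)%nat h).
Qed.

Lemma Def_R3 R a b c : DR3 R -> TDef a -> TDef b -> TDef c ->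
  Def (fun X e => R (a X e) (b X e) (c X e)).
Proof.
  intros h ha hb hc.
  apply (Def_subst1 (A := fun X e x => R x (b X e) (c X e))); [|exact ha].
  apply (Def_subst1 (A := fun X e y => R (e 0%nat) y (c X (fun i => e (S i)))));
    [|exact (TDef_ren S hb)].
  apply (Def_subst1 (A := fun X e y => R (e 1%nat) (e 0%nat) y));
    [|exact (TDef_ren (fun i => S (S i)) hc)].
  exact (Def_ren (fun i => match i with 0 => 2 | 1 => 1 | 2 => 0 | i => i end)%nat h).
Qed.

Lemma Def_R4 R a b c d : DR4 R -> TDef a -> TDef b -> TDef c -> TDef d ->
  Def (fun X e => R (a X e) (b X e) (c X e) (d X e)).
Proof.
  intros h ha hb hc hd.
  apply (Def_subst1 (A := fun X e x => R x (b X e) (c X e) (d X e))); [|exact ha].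
  apply (Def_subst1 (A := fun X e y => R (e 0%nat) y (c X (fun i => e (S i)))
    (d X (fun i => e (S i)))));
    [|exact (TDef_ren S hb)].
  apply (Def_subst1 (A := fun X e y => R (e 1%nat) (e 0%nat) y (d X (fun i => e (S (S i))))));
    [|exact (TDef_ren (fun i => S (S i)) hc)].
  apply (Def_subst1 (A := fun X e y => R (e 2%nat) (e 1%nat) (e 0%nat) y));
    [|exact (TDef_ren (fun i => S (S (S i))) hd)].
  exact (Def_ren (fun i => match i with 0 => 3 | 1 => 2 | 2 => 1 | 3 => 0 | i => i end)%nat h).
Qed.

Lemma TDef_F1 f a : DF1 f -> TDef a -> TDef (fun X e => f (a X e)).
Proof.
  intros h ha.
  apply (@Def_R2 (fun y x => y = f x) (fun X e => e 0%nat)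
    (fun X e => a X (fun i => e (S i))));
    [exact h | apply TDef_var | exact (TDef_ren S ha)].
Qed.

Lemma TDef_F2 f a b : DF2 f -> TDef a -> TDef b -> TDef (fun X e => f (a X e) (b X e)).
Proof.
  intros h ha hb.
  apply (@Def_R3 (fun y x z => y = f x z) (fun X e => e 0%nat)
    (fun X e => a X (fun i => e (S i))) (fun X e => b X (fun i => e (S i))));
    [exact h | apply TDef_var | exact (TDef_ren S ha) | exact (TDef_ren S hb)].
Qed.

Lemma TDef_F3 f a b c : DF3 f -> TDef a -> TDef b -> TDef c ->
  TDef (fun X e => f (a X e) (b X e) (c X e)).
Proof.
  intros h ha hb hc.
  apply (@Def_R4 (fun y x z w => y = f x z w) (fun X e => e 0%nat)
    (fun X e => a X (fun i => e (S i))) (fun X e => b X (fun i => e (S i)))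
    (fun X e => c X (fun i => e (S i))));
    [exact h | apply TDef_var | exact (TDef_ren S ha) | exact (TDef_ren S hb)
    | exact (TDef_ren S hc)].
Qed.

Lemma DR1_sets R : sets R -> DR1 R.
Proof. apply Def_mem. Qed.
Lemma DR2_lt : DR2 (@lt M).
Proof. exact (Def_formula (flt (tvar 0) (tvar 1))). Qed.
Lemma DR2_eq : DR2 (@eq N).
Proof. exact (Def_formula (feq (tvar 0) (tvar 1))). Qed.
Lemma DF2_add : DF2 (@add M).
Proof. exact (Def_formula (feq (tvar 0) (tadd (tvar 1) (tvar 2)))). Qed.
Lemma DF2_mul : DF2 (@mul M).
Proof. exact (Def_formula (feq (tvar 0) (tmul (tvar 1) (tvar 2)))). Qed.
Lemma DF2_pair : DF2 (@pair M).
Proof.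
  exact (Def_formula (feq (tvar 0) (tadd (tmul (tadd (tvar 1) (tvar 2))
    (tadd (tvar 1) (tvar 2))) (tvar 1)))).
Qed.

End Definability.

(* Automation of definability proofs *)
Create HintDb defs discriminated.
#[export] Hint Resolve DR2_lt DR2_eq DF2_add DF2_mul DF2_pair : defs.
#[export] Hint Extern 1 (DR1 _) => apply DR1_sets; assumption : defs.

(** A hook, redefined below as minimisation, case distinction and restriction to finite sequences
    acquire their own definability lemmas. *)
Ltac defn_extra := fail.
Ltac defn1 :=
  cbn beta;
  first [defn_extra |
  lazymatch goal with
  | |- sets _ => apply comprehension
  | |- DR1 _ => first [solve [eauto 3 with defs] | progress unfold DR1]
  | |- DR2 _ => first [solve [eauto 3 with defs] | progress unfold DR2]
  | |- DR3 _ => first [solve [eauto 3 with defs] | progress unfold DR3]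
  | |- DR4 _ => first [solve [eauto 3 with defs] | progress unfold DR4]
  | |- DF1 _ => first [solve [eauto 3 with defs] | progress unfold DF1]
  | |- DF2 _ => first [solve [eauto 3 with defs] | progress unfold DF2]
  | |- DF3 _ => first [solve [eauto 3 with defs] | progress unfold DF3]
  | |- Def (fun X e => _ /\ _) => apply Def_and
  | |- Def (fun X e => _ \/ _) => apply Def_or
  | |- Def (fun X e => ~ _) => apply Def_not
  | |- Def (fun X e => _ <-> _) => apply Def_equiv
  | |- Def (fun X e => exists a, _) => apply Def_ex
  | |- Def (fun X e => forall a, _) => first [apply Def_imp | apply Def_all]
  | |- Def _ =>
      first [ apply Def_const | apply Def_var_mem
            | apply Def_R1; [solve [eauto 3 with defs]|]
            | apply Def_R2; [solve [eauto 3 with defs]| |]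
            | apply Def_R3; [solve [eauto 3 with defs]| | |]
            | apply Def_R4; [solve [eauto 3 with defs]| | | |] ]
  | |- TDef _ =>
      first [ apply TDef_const | apply TDef_var
            | apply TDef_F1; [solve [eauto 3 with defs]|]
            | apply TDef_F2; [solve [eauto 3 with defs]| |]
            | apply TDef_F3; [solve [eauto 3 with defs]| | |] ]
  end].
Ltac defn := repeat defn1.

(** * Arithmetic in the structure *)

Section Arithmetic.
Context {M : L2_structure} {hM : model M}.
Local Open Scope L2_scope.
Notation N := (num M).

Lemma induction (phi : N -> Prop) :
  sets phi -> phi 0 -> (forall n, phi n -> phi (n + 1)) -> forall n, phi n.
Proof. exact (@ACA0_ind M model_ACA0 phi). Qed.

Let ax : basic_axioms M := ACA0_basic model_ACA0.

Lemma add0 (n : N) : 0 + n = n.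
Proof.
  revert n; apply induction; [defn | apply (addn0 ax) |].
  intros n h; rewrite (addnS ax), h; reflexivity.
Qed.

Lemma addS1 (m n : N) : (m + 1) + n = (m + n) + 1.
Proof.
  revert n; apply induction; [defn | now rewrite !(addn0 ax) |].
  intros n h; rewrite !(addnS ax), h; reflexivity.
Qed.

Lemma addC (m n : N) : m + n = n + m.
Proof.
  revert n; apply induction; [defn | now rewrite add0, (addn0 ax) |].
  intros n h; rewrite (addnS ax), addS1, h; reflexivity.
Qed.

Lemma addA (a b c : N) : a + (b + c) = (a + b) + c.
Proof.
  revert c; apply induction; [defn | now rewrite !(addn0 ax) |].
  intros n h; rewrite !(addnS ax), h; reflexivity.
Qed.

Lemma mul0 (n : N) : 0 * n = 0.
Proof.
  revert n; apply induction; [defn | apply (muln0 ax) |].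
  intros n h; rewrite (mulnS ax), h; apply add0.
Qed.

Lemma mulS1 (m n : N) : (m + 1) * n = m * n + n.
Proof.
  revert n; apply induction; [defn | now rewrite !(muln0 ax), add0 |].
  intros n h; rewrite !(mulnS ax), h.
  rewrite <- !addA; f_equal. rewrite !addA, (addC n m); reflexivity.
Qed.

Lemma mulC (m n : N) : m * n = n * m.
Proof.
  revert n; apply induction; [defn | now rewrite mul0, (muln0 ax) |].
  intros n h; rewrite (mulnS ax), mulS1, h; reflexivity.
Qed.

Lemma mul1 (n : N) : 1 * n = n.
Proof. rewrite <- (add0 1), mulS1, mul0; apply add0. Qed.

Lemma mulDl (a b c : N) : (a + b) * c = a * c + b * c.
Proof.
  revert c; apply induction; [defn | now rewrite !(muln0 ax), add0 |].
  intros n h; rewrite !(mulnS ax), h.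
  rewrite <- !addA; f_equal. rewrite !addA, (addC _ a); reflexivity.
Qed.

Lemma mulA (a b c : N) : a * (b * c) = (a * b) * c.
Proof.
  revert c; apply induction; [defn | now rewrite !(muln0 ax) |].
  intros n h; rewrite !(mulnS ax), <- h.
  rewrite (mulC a (_ + _)), mulDl, (mulC (b * n)), (mulC b a); reflexivity.
Qed.

Lemma num_srt : semi_ring_theory 0 1 (@add M) (@mul M) (@eq N).
Proof.
  constructor; auto using add0, addC, addA, mul0, mul1, mulC, mulA, mulDl.
Qed.
Add Ring num_ring : num_srt.

Lemma zero_or_succ (n : N) : n = 0 \/ exists m, n = m + 1.
Proof.
  revert n; apply induction; [defn | auto | eauto].
Qed.

Lemma neq_succ0 (n : N) : n + 1 <> 0.
Proof. apply (succ_neq0 ax). Qed.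

Lemma add_cancel_r (a b c : N) : a + c = b + c -> a = b.
Proof.
  revert c; apply (@induction (fun c => a + c = b + c -> a = b)); [defn | |].
  - now rewrite !(addn0 ax).
  - intros n h; rewrite !(addnS ax); intro k; apply h, (succ_inj ax k).
Qed.

Lemma add_cancel_l (a b c : N) : c + a = c + b -> a = b.
Proof. rewrite !(addC c); apply add_cancel_r. Qed.

Lemma lt_iff (m n : N) : m < n <-> exists d, n = m + d + 1.
Proof.
  revert n; apply induction; [defn | |].
  - split; [intro h; destruct (ltn0 ax h) | intros [d h]].
    destruct (neq_succ0 (eq_sym h)).
  - intros n h; rewrite (ltnS ax), h; split.
    + intros [[d ->] | ->]; [exists (d + 1) | exists 0]; ring.
    + intros [d hd]. assert (n = m + d) by (apply (succ_inj ax); exact hd).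
      destruct (zero_or_succ d) as [-> | [d' ->]].
      * right; rewrite H; ring.
      * left; exists d'; rewrite H; ring.
Qed.

Lemma le_iff (m n : N) : m <= n <-> exists d, n = m + d.
Proof.
  rewrite lt_iff; split.
  - intros [[d ->] | ->]; [exists (d + 1) | exists 0]; ring.
  - intros [d ->]; destruct (zero_or_succ d) as [-> | [d' ->]];
      [right | left; exists d']; ring.
Qed.

Lemma nlt0 (m : N) : ~ m < 0.
Proof. apply (ltn0 ax). Qed.

Lemma lt_succ (m n : N) : m < n + 1 <-> m <= n.
Proof. apply (ltnS ax). Qed.

Lemma lt_irrefl (m : N) : ~ m < m.
Proof.
  rewrite lt_iff; intros [d h].
  apply (@neq_succ0 d), (@add_cancel_l _ _ m); rewrite (addn0 ax), addA; auto.
Qed.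

Lemma lt_trans (a b c : N) : a < b -> b < c -> a < c.
Proof.
  rewrite !lt_iff; intros [d ->] [d' ->]; exists (d + d' + 1); ring.
Qed.

Lemma lt_le_trans (a b c : N) : a < b -> b <= c -> a < c.
Proof. intros h [k | <-]; [exact (lt_trans h k) | exact h]. Qed.

Lemma le_lt_trans (a b c : N) : a <= b -> b < c -> a < c.
Proof. intros [h | ->] k; [exact (lt_trans h k) | exact k]. Qed.

Lemma le_trans (a b c : N) : a <= b -> b <= c -> a <= c.
Proof. intros [h | ->] k; [left; exact (lt_le_trans h k) | exact k]. Qed.

Lemma le0n (n : N) : 0 <= n.
Proof. apply le_iff; exists n; ring. Qed.

Lemma lt_succ_diag (n : N) : n < n + 1.
Proof. apply lt_succ; auto. Qed.

Lemma lt_le_succ (m n : N) : m < n -> m + 1 <= n.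
Proof. rewrite lt_iff, le_iff; intros [d ->]; exists d; ring. Qed.

Lemma lt_total (m n : N) : m < n \/ m = n \/ n < m.
Proof.
  revert n; apply induction; [defn | |].
  - destruct (le0n m); auto.
  - intros n [h | [-> | h]].
    + left; apply lt_succ; auto.
    + left; apply lt_succ_diag.
    + destruct (lt_le_succ h) as [k | <-]; auto.
Qed.

Lemma not_lt (m n : N) : ~ m < n -> n <= m.
Proof. destruct (lt_total m n) as [h | [h | h]]; auto; tauto. Qed.

Lemma not_le (m n : N) : ~ m <= n -> n < m.
Proof. destruct (lt_total m n) as [h | [h | h]]; auto; tauto. Qed.

Lemma neq_lt (m n : N) : m <> n -> m < n \/ n < m.
Proof. destruct (lt_total m n) as [h | [h | h]]; auto; tauto. Qed.

End Arithmetic.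

(** * Automation for order facts *)

Ltac add_lt a b pf :=
  lazymatch goal with
  | _ : lt a b |- _ => fail
  | _ => assert (lt a b) by exact pf
  end.
Ltac add_le a b pf :=
  lazymatch goal with
  | _ : (lt a b \/ a = b) |- _ => fail
  | _ : lt a b |- _ => fail
  | _ => tryif constr_eq a b then fail else assert (lt a b \/ a = b) by exact pf
  end.

(* Refutes the negated goal by closing the order facts of the context under
   transitivity and successor. *)
Ltac ord_step :=
  match goal with
  | H : lt ?a ?a |- _ => exfalso; exact (lt_irrefl H)
  | H : lt ?a zero |- _ => exfalso; exact (nlt0 H)
  | H : ?a <> ?a |- _ => exfalso; exact (H eq_refl)
  | H : add ?a one = zero |- _ => exfalso; exact (neq_succ0 H)
  | H : zero = add ?a one |- _ => exfalso; exact (neq_succ0 (eq_sym H))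
  | H : ~ (lt ?a ?b \/ ?a = ?b) |- _ => apply not_le in H
  | H : ~ (lt ?a ?b) |- _ => apply not_lt in H
  | H : add ?a one = add ?b one |- _ => apply add_cancel_r in H; subst
  | H : lt ?a (add ?b one) |- _ => add_le a b (proj1 (lt_succ a b) H)
  | H : lt ?a ?b |- _ =>
      lazymatch goal with |- context [add a one] => idtac | _ : context [add a one] |- _ => idtac end;
      add_le (add a (@one _)) b (lt_le_succ H)
  | H : lt ?a ?b, K : lt ?b ?c |- _ => add_lt a c (lt_trans H K)
  | H : lt ?a ?b, K : (lt ?b ?c \/ ?b = ?c) |- _ => add_lt a c (lt_le_trans H K)
  | H : (lt ?a ?b \/ ?a = ?b), K : lt ?b ?c |- _ => add_lt a c (le_lt_trans H K)
  | H : (lt ?a ?b \/ ?a = ?b), K : (lt ?b ?c \/ ?b = ?c) |- _ => add_le a c (le_trans H K)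
  | H : ?a = ?b |- _ => add_le a b (or_intror H : lt a b \/ a = b)
  | H : ?a = ?b |- _ => add_le b a (or_intror (eq_sym H) : lt b a \/ b = a)
  | |- context [add ?a one] => add_lt a (add a (@one _)) (lt_succ_diag a)
  | _ : context [add ?a one] |- _ => add_lt a (add a (@one _)) (lt_succ_diag a)
  | H : ?a <> ?b |- _ => apply neq_lt in H; destruct H
  end.
Ltac ord :=
  intros; subst;
  lazymatch goal with
  | |- False => idtac
  | |- ~ _ => intro
  | |- ?a = ?b => let H := fresh in apply NNPP; intro H; apply neq_lt in H; destruct H as [H|H]
  | |- _ => apply NNPP; intro
  end;
  solve [repeat ord_step].

(** * Least number principle, minimisation and definition by cases *)

Section LeastNumber.
Context {M : L2_structure} {hM : model M}.
Local Open Scope L2_scope.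
Notation N := (num M).
Notation env := (nat -> num M).
Add Ring num_ring : (num_srt (M := M)).

Lemma strong_induction (phi : N -> Prop) :
  sets phi -> (forall n, (forall m, m < n -> phi m) -> phi n) -> forall n, phi n.
Proof.
  intros h step n.
  assert (forall k m, m < k -> phi m) as H.
  { apply (@induction M hM (fun k => forall m, m < k -> phi m)); [defn | |].
    - intros m k; destruct (nlt0 k).
    - intros k IH m hm. apply step; intros m' hm'. apply IH; ord. }
  apply (H (n + 1)), lt_succ_diag.
Qed.

Lemma least_number (phi : N -> Prop) : sets phi -> (exists n, phi n) ->
  exists n, phi n /\ forall m, m < n -> ~ phi m.
Proof.
  intros h [n hn]; apply NNPP; intro k. revert hn.
  apply (@strong_induction (fun n => ~ phi n)); [defn|].
  intros m IH hm; apply k; eauto.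
Qed.

Definition least (phi : N -> Prop) (n : N) : Prop :=
  phi n /\ forall m, m < n -> ~ phi m.

Lemma least_unique phi (m n : N) : least phi m -> least phi n -> m = n.
Proof.
  intros [h1 h2] [k1 k2].
  destruct (lt_total m n) as [l | [l | l]]; [destruct (k2 _ l h1) | exact l | destruct (h2 _ l k1)].
Qed.

(** When [phi] is a set, the predicate handed to [epsilon] has exactly one solution, so the operator
    has a definable graph ([TDef_mu]). The default for an empty [phi] is 0. *)
Definition mu (phi : N -> Prop) : N :=
  epsilon (inhabits 0) (fun n => least phi n \/ (n = 0 /\ forall m, ~ phi m)).

Lemma mu_cases phi : sets phi ->
  least phi (mu phi) \/ (mu phi = 0 /\ forall m, ~ phi m).
Proof.
  intro h. apply (epsilon_spec (inhabits 0)
    (fun n => least phi n \/ (n = 0 /\ forall m, ~ phi m))).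
  destruct (classic (exists n, phi n)) as [k|k].
  - destruct (least_number h k) as [n hn]; exists n; left; exact hn.
  - exists 0; right; split; [reflexivity|]; intros m hm; apply k; eauto.
Qed.

Lemma mu_spec (phi : N -> Prop) : sets phi -> (exists n, phi n) -> phi (mu phi).
Proof.
  intros h [n k]; destruct (mu_cases h) as [[l _] | [_ l]]; [exact l | destruct (l n k)].
Qed.

Lemma mu_eq phi (n : N) : sets phi -> least phi n -> mu phi = n.
Proof.
  intros h k; destruct (mu_cases h) as [l | [_ l]].
  - exact (least_unique l k).
  - destruct k as [k _]; destruct (l n k).
Qed.

Lemma TDef_mu (A : (N -> Prop) -> env -> N -> Prop) :
  Def (fun X e => A X (fun i => e (S i)) (e O)) -> TDef (fun X e => mu (A X e)).
Proof.
  intro h.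
  apply (Def_iff (A := fun X e => least (A X (fun i => e (S i))) (e O)
     \/ (e O = 0 /\ forall m, ~ A X (fun i => e (S i)) m))).
  - intros X e hX.
    pose proof (Def_sets h (X := X) (fun i => e (S i)) hX) as hs. split.
    + intros [k | [-> k]].
      * symmetry; exact (mu_eq hs k).
      * destruct (mu_cases hs) as [[l _] | [-> _]]; [destruct (k _ l) | reflexivity].
    + intros ->; exact (mu_cases hs).
  - unfold least.
    apply Def_or; apply Def_and; [exact h | | defn | ].
    + apply Def_all, Def_imp; [defn|]. apply Def_not.
      exact (Def_ren (fun i => match i with O => O | S i => S (S i) end) h).
    + apply Def_all, Def_not.
      exact (Def_ren (fun i => match i with O => O | S i => S (S i) end) h).
Qed.

Definition ite (A : Prop) (a b : N) : N :=
  if excluded_middle_informative A then a else b.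

Lemma ite_true (A : Prop) a b : A -> ite A a b = a.
Proof. unfold ite; destruct excluded_middle_informative; tauto. Qed.
Lemma ite_false (A : Prop) a b : ~ A -> ite A a b = b.
Proof. unfold ite; destruct excluded_middle_informative; tauto. Qed.

Lemma TDef_ite A a b : Def A -> TDef a -> TDef b ->
  TDef (fun X e => ite (A X e) (a X e) (b X e)).
Proof.
  intros hA ha hb.
  pose proof (Def_ren S hA) as hA'.
  apply (Def_iff (A := fun X e => (A X (fun i => e (S i)) /\ e O = a X (fun i => e (S i)))
    \/ (~ A X (fun i => e (S i)) /\ e O = b X (fun i => e (S i))))).
  - intros X e _; unfold ite; destruct excluded_middle_informative; tauto.
  - apply Def_or; apply Def_and; auto; apply Def_not; exact hA'.
Qed.

End LeastNumber.

Ltac defn_extra ::=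
  lazymatch goal with
  | |- TDef (fun X e => mu _) => apply TDef_mu
  | |- TDef (fun X e => ite _ _ _) => apply TDef_ite
  end.

(** * Ordered pairs and their projections *)

Section Pairs.
Context {M : L2_structure} {hM : model M}.
Local Open Scope L2_scope.
Notation N := (num M).
Add Ring num_ring : (num_srt (M := M)).

Lemma mul_lt_mono (a b c : N) : 0 < c -> a < b -> a * c < b * c.
Proof.
  rewrite !lt_iff; intros [u ->] [v ->]. exists (u + v * (u + 1)); ring.
Qed.

Lemma mul_le_mono (a b c : N) : a <= b -> a * c <= b * c.
Proof. rewrite !le_iff; intros [u ->]; exists (u * c); ring. Qed.

Lemma mul_le_cancel (a b c : N) : 0 < c -> a * c <= b * c -> a <= b.
Proof.
  intros hc h; apply NNPP; intro k; apply not_le in k.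
  apply (mul_lt_mono hc) in k. ord.
Qed.

Lemma pos_mul (a b : N) : 0 < a -> 0 < b -> 0 < a * b.
Proof. intros ha hb; rewrite <- (mul0 b); apply mul_lt_mono; auto. Qed.

Lemma add_le_mono (a b c d : N) : a <= b -> c <= d -> a + c <= b + d.
Proof. rewrite !le_iff; intros [u ->] [v ->]; exists (u + v); ring. Qed.

Lemma add_le_cancel (a b c : N) : a + c <= b + c -> a <= b.
Proof.
  rewrite !le_iff; intros [u h]; exists u. apply (@add_cancel_r _ _ _ _ c).
  rewrite h; ring.
Qed.

(** With s = i + j, the code lies between the squares of s and s + 1, so the sums alone decide the
    comparison. This makes the sum, and then both components, recoverable from the code. *)
Lemma pair_lt (i j i' j' : N) : i + j < i' + j' -> pair i j < pair i' j'.
Proof.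
  unfold pair; rewrite !lt_iff; intros [d ->].
  exists (j + (i + j) + d * d + (1 + 1) * (i + j) * d + (1 + 1) * d + i'); ring.
Qed.

Lemma pair_inj (i j i' j' : N) : pair i j = pair i' j' -> i = i' /\ j = j'.
Proof.
  intro h; destruct (lt_total (i + j) (i' + j')) as [k | [k | k]].
  - apply pair_lt in k; rewrite h in k; destruct (lt_irrefl k).
  - unfold pair in h; rewrite k in h; apply add_cancel_l in h; subst i'.
    split; [reflexivity | exact (add_cancel_l k)].
  - apply pair_lt in k; rewrite h in k; destruct (lt_irrefl k).
Qed.

Lemma pair_lt_r (i j j' : N) : j < j' -> pair i j < pair i j'.
Proof.
  intro h; apply pair_lt; revert h; rewrite !lt_iff; intros [d ->]; exists d; ring.
Qed.

Lemma le_square (a : N) : a <= a * a.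
Proof.
  destruct (zero_or_succ a) as [-> | [b ->]]; apply le_iff; [exists 0 | exists (b * (b + 1))]; ring.
Qed.

Lemma le_pair_r (i j : N) : j <= pair i j.
Proof.
  apply le_trans with (i + j); [apply le_iff; exists i; ring|].
  apply le_trans with (1 := le_square _). apply le_iff; unfold pair; exists i; ring.
Qed.

Definition fst (z : N) : N := mu (fun i => exists j, z = pair i j).
Definition snd (z : N) : N := mu (fun j => exists i, z = pair i j).

Lemma DF1_fst : DF1 fst. Proof. unfold fst; defn. Qed.
Lemma DF1_snd : DF1 snd. Proof. unfold snd; defn. Qed.

Lemma fst_pair (i j : N) : fst (pair i j) = i.
Proof.
  destruct (@mu_spec M hM (fun i' => exists j', pair i j = pair i' j')) as [j' h];
    [defn | eauto |].
  apply pair_inj in h; symmetry; apply h.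
Qed.

Lemma snd_pair (i j : N) : snd (pair i j) = j.
Proof.
  destruct (@mu_spec M hM (fun j' => exists i', pair i j = pair i' j')) as [i' h];
    [defn | eauto |].
  apply pair_inj in h; symmetry; apply h.
Qed.

End Pairs.
#[export] Hint Resolve DF1_fst DF1_snd : defs.

(** * Finite sequences *)

Section Sequences.
Context {M : L2_structure} {hM : model M}.
Local Open Scope L2_scope.
Notation N := (num M).
Notation env := (nat -> num M).
Add Ring num_ring : (num_srt (M := M)).

Definition divides (a b : N) : Prop := exists q, b = a * q.
Lemma DR2_divides : DR2 divides. Proof. unfold divides; defn. Qed.
Hint Resolve DR2_divides : defs.

Lemma divides_mulr (a b c : N) : divides a b -> divides a (b * c).
Proof. intros [q ->]; exists (q * c); ring. Qed.

Lemma divides_cancel (a b c : N) :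
  0 < a -> divides a b -> divides a (b + c) -> divides a c.
Proof.
  intros ha [q ->] [r h].
  assert (q <= r) as k.
  { apply (mul_le_cancel ha). apply le_iff; exists c.
    rewrite (mulC r), <- h; ring. }
  apply le_iff in k; destruct k as [u ->]. exists u.
  apply (@add_cancel_l _ _ _ _ (a * q)); rewrite h; ring.
Qed.

(** The inductive step multiplies by n + 1, so the number produced is the factorial of n. *)
Lemma common_multiple (n : N) :
  exists d, 0 < d /\ forall k, 0 < k -> k <= n -> divides k d.
Proof.
  revert n; apply induction; [defn | |].
  - exists 1; split; [apply lt_iff; exists 0; ring | intros; ord].
  - intros n (d & hd & h); exists (d * (n + 1)); split.
    + apply pos_mul; [exact hd | apply lt_iff; exists n; ring].
    + intros k hk [hk' | ->].
      * apply divides_mulr, h; [exact hk | ord].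
      * exists d; ring.
Qed.

(** The moduli of Gödel's beta function: if all positive numbers up to n divide d, those with z < n
    are pairwise coprime. *)
Definition modulus (d z : N) : N := 1 + (z + 1) * d.
Lemma DF2_modulus : DF2 modulus. Proof. unfold modulus; defn. Qed.
Hint Resolve DF2_modulus : defs.

Lemma modulus_pos d z : 0 < modulus d z.
Proof. apply lt_iff; exists ((z + 1) * d); unfold modulus; ring. Qed.

(* (x+1) m_y - (y+1) m_x = x - y, which divides d, and m_x is prime to d. *)
Lemma modulus_coprime (d n x y c : N) :
  (forall k, 0 < k -> k <= n -> divides k d) -> x < n -> y < n -> x <> y ->
  divides (modulus d x) (modulus d y * c) -> divides (modulus d x) c.
Proof.
  intros hd hx hy hxy [u hu].
  assert (forall e, e + 1 <= n -> divides (modulus d x) ((e + 1) * c) ->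
            divides (modulus d x) c) as K.
  { intros e he k. destruct (hd (e + 1)) as [q hq]; [apply lt_iff; exists e; ring | exact he |].
    apply (@divides_cancel _ ((e + 1) * c * (q * (x + 1)))).
    - apply modulus_pos.
    - apply divides_mulr, k.
    - exists c; unfold modulus; rewrite hq; ring. }
  apply neq_lt in hxy; destruct hxy as [h | h]; apply lt_iff in h; destruct h as [e h].
  - apply (K e).
    { apply lt_le_succ, le_lt_trans with (2 := hy); apply le_iff; exists (x + 1); rewrite h; ring. }
    apply (@divides_cancel _ (modulus d x * ((x + 1) * u))).
    + apply modulus_pos.
    + eexists; reflexivity.
    + exists ((y + 1) * c).
      replace (modulus d x * ((x + 1) * u)) with ((x + 1) * (modulus d y * c))
        by (rewrite hu; ring).
      unfold modulus; rewrite h; ring.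
  - apply (K e).
    { apply lt_le_succ, le_lt_trans with (2 := hx); apply le_iff; exists (y + 1); rewrite h; ring. }
    apply (@divides_cancel _ (modulus d x * ((y + 1) * c))).
    + apply modulus_pos.
    + eexists; reflexivity.
    + exists ((x + 1) * u).
      replace (modulus d x * ((x + 1) * u)) with ((x + 1) * (modulus d y * c))
        by (rewrite hu; ring).
      unfold modulus; rewrite h; ring.
Qed.

(** The code c is the product of the moduli of the elements of X below n. By coprimality a modulus
    with index below n divides this product only if it is one of the factors. *)
Lemma finite_set_code (X : N -> Prop) (n : N) : sets X ->
  exists c d, forall z, z < n -> (divides (modulus d z) c <-> X z).
Proof.
  intro hX. destruct (common_multiple n) as (d & hd0 & hd).
  assert (forall k, exists c, forall z, z < n -> (divides (modulus d z) c <-> X z /\ z < k)) as H.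
  { apply induction; [defn | |].
    - exists 1; intros z hz; split; [intros [q hq] | intros [_ h]; destruct (nlt0 h)].
      exfalso; destruct (zero_or_succ q) as [-> | [r ->]].
      + apply (@neq_succ0 M hM 0). rewrite add0, hq; ring.
      + apply lt_iff in hd0; destruct hd0 as [d' ->]. revert hq.
        unfold modulus. intro hq.
        apply (@lt_irrefl M hM 1). rewrite hq at 2. apply lt_iff.
        exists (z * (0 + d' + 1) + d' + (1 + (z + 1) * (0 + d' + 1)) * r); ring.
    - intros k [c hc].
      (* Coprimality is available only for indices below n, so no factor with index at or beyond n
         is multiplied in. *)
      destruct (classic (X k /\ k < n)) as [[hk kn] | hk].
      + exists (modulus d k * c); intros z hz.
        destruct (classic (z = k)) as [-> | hzk].
        * split; [intros _; split; [exact hk | ord] | intros _; exists c; ring].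
        * split.
          -- intro h; apply (@modulus_coprime d n) in h; auto.
             apply hc in h; [|exact hz]. split; [apply h | destruct h; ord].
          -- intros [h1 h2]. rewrite mulC; apply divides_mulr, hc; [exact hz|].
             split; [exact h1 | ord].
      + exists c; intros z hz; rewrite hc by exact hz. split; intros [h1 h2]; split; auto.
        * ord.
        * apply lt_succ in h2; destruct h2 as [h2 | ->]; [exact h2 | tauto]. }
  destruct (H n) as [c hc]; exists c, d; intros z hz; rewrite (hc z hz); tauto.
Qed.

(* A sequence is coded by its length and a code of its graph as in
   [finite_set_code]; [Seq] selects the least code of each sequence. *)
Definition len (s : N) : N := fst s.
Definition ent (s i : N) : N :=
  mu (fun y => divides (modulus (snd (snd s)) (pair i y)) (fst (snd s))).
Definition Seq (s : N) : Prop :=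
  forall s', s' < s -> ~ (len s' = len s /\ forall i, i < len s -> ent s' i = ent s i).
Definition restr (f : N -> N) (n : N) : N :=
  mu (fun s => len s = n /\ forall i, i < n -> ent s i = f i).

Lemma DF1_len : DF1 len. Proof. unfold len; defn. Qed.
Lemma DF2_ent : DF2 ent. Proof. unfold ent; defn. Qed.
Hint Resolve DF1_len DF2_ent : defs.
Lemma DR1_Seq : DR1 Seq. Proof. unfold Seq; defn. Qed.
Lemma TDef_restr (f : (N -> Prop) -> env -> N -> N) n :
  TDef (fun X e => f X (fun i => e (S i)) (e O)) -> TDef n ->
  TDef (fun X e => restr (f X e) (n X e)).
Proof.
  intros hf hn; unfold restr. apply TDef_mu, Def_and.
  - exact (Def_R2 DR2_eq (TDef_F1 DF1_len (TDef_var _)) (TDef_ren S hn)).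
  - apply Def_all, Def_imp.
    + exact (Def_R2 DR2_lt (TDef_var 0) (TDef_ren (fun i => S (S i)) hn)).
    + apply Def_R2; [exact DR2_eq | defn |].
      exact (TDef_ren (fun i => match i with O => O | S i => S (S i) end) hf).
Qed.

Lemma restr_ex (f : N -> N) n : DF1 f ->
  exists s, len s = n /\ forall i, i < n -> ent s i = f i.
Proof.
  intro hf.
  (* [finite_set_code] codes a set only below a given number, so the finite graph is bounded
     first. *)
  assert (exists b, forall i, i < n -> pair i (f i) < b) as [b hb].
  { revert n; apply induction; [defn | |].
    - exists 0; intros i hi; destruct (nlt0 hi).
    - intros n [b hb]. exists (b + pair n (f n) + 1). intros i hi.
      apply lt_succ in hi; destruct hi as [hi | ->].
      + apply lt_le_trans with (1 := hb i hi). apply le_iff.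
        exists (pair n (f n) + 1); ring.
      + apply lt_iff; exists b; ring. }
  destruct (@finite_set_code (fun z => exists i, i < n /\ z = pair i (f i)) b) as (c & d & h);
    [defn|].
  exists (pair n (pair c d)); split; [apply fst_pair|].
  intros i hi; unfold ent; rewrite !snd_pair, fst_pair.
  apply mu_eq; [defn|]. split.
  - apply h; [exact (hb i hi) | eauto].
  (* A smaller candidate y has a smaller pair code, still below the bound b, where divisibility
     decides membership in the graph correctly. *)
  - intros y hy k. apply h in k.
    + destruct k as (i' & _ & k); apply pair_inj in k; destruct k as [<- ->].
      exact (lt_irrefl hy).
    + apply lt_trans with (2 := hb i hi), pair_lt_r, hy.
Qed.

Section Restriction.
Context (f : N -> N) (hf : DF1 f).

Lemma restr_spec n : len (restr f n) = n /\ forall i, i < n -> ent (restr f n) i = f i.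
Proof.
  apply (@mu_spec M hM (fun s => len s = n /\ forall i, i < n -> ent s i = f i));
    [defn | exact (restr_ex n hf)].
Qed.

Lemma len_restr n : len (restr f n) = n.
Proof. apply restr_spec. Qed.
Lemma ent_restr n i : i < n -> ent (restr f n) i = f i.
Proof. apply restr_spec. Qed.
Lemma Seq_restr n : Seq (restr f n).
Proof.
  destruct (@mu_cases M hM (fun s => len s = n /\ forall i, i < n -> ent s i = f i))
    as [[_ h] | [_ h]]; [defn | |].
  - intros s hs [h1 h2]. rewrite len_restr in h1, h2. apply (h s hs).
    split; [exact h1|]. intros i hi; rewrite h2, ent_restr; auto.
  - destruct (restr_ex n hf) as [s hs]; destruct (h s hs).
Qed.
End Restriction.

Lemma Seq_ext s t : Seq s -> Seq t -> len s = len t ->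
  (forall i, i < len s -> ent s i = ent t i) -> s = t.
Proof.
  intros hs ht h k; destruct (lt_total s t) as [l | [l | l]]; [exfalso | exact l | exfalso].
  - apply (ht s l); split; [exact h|]; intros i hi; apply k; now rewrite h.
  - apply (hs t l); split; [now symmetry|]; intros i hi; symmetry; apply k; exact hi.
Qed.

Definition emp : N := restr (fun _ => 0) 0.
Definition take (s k : N) : N := restr (ent s) k.
Definition app (s m : N) : N := restr (fun i => ite (i < len s) (ent s i) m) (len s + 1).

Lemma DF2_take : DF2 take.
Proof. unfold take; unfold DF2; apply TDef_restr; defn. Qed.
Lemma DF2_app : DF2 app.
Proof. unfold app; unfold DF2; apply TDef_restr; defn. Qed.

Lemma DF1_ent s : DF1 (ent s). Proof. defn. Qed.
Lemma DF1_app s m : DF1 (fun i => ite (i < len s) (ent s i) m). Proof. defn. Qed.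
Lemma DF1_cst (c : N) : DF1 (fun _ => c). Proof. defn. Qed.

Lemma Seq_emp : Seq emp. Proof. apply Seq_restr, DF1_cst. Qed.
Lemma len_emp : len emp = 0. Proof. apply len_restr, DF1_cst. Qed.
Lemma Seq_take s k : Seq (take s k). Proof. apply Seq_restr, DF1_ent. Qed.
Lemma len_take s k : len (take s k) = k. Proof. apply len_restr, DF1_ent. Qed.
Lemma ent_take s k i : i < k -> ent (take s k) i = ent s i.
Proof. apply ent_restr, DF1_ent. Qed.
Lemma Seq_app s m : Seq (app s m). Proof. apply Seq_restr, DF1_app. Qed.
Lemma len_app s m : len (app s m) = len s + 1. Proof. apply len_restr, DF1_app. Qed.
Lemma ent_app s m i : i < len s -> ent (app s m) i = ent s i.
Proof.
  intro h; unfold app; rewrite ent_restr; [apply ite_true, h | apply DF1_app | ord].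
Qed.
Lemma ent_app_last s m : ent (app s m) (len s) = m.
Proof.
  unfold app; rewrite ent_restr; [apply ite_false, lt_irrefl | apply DF1_app | ord].
Qed.

Lemma take_restr f k n : DF1 f -> k <= n -> take (restr f n) k = restr f k.
Proof.
  intros hf h; apply Seq_ext; [apply Seq_take | apply Seq_restr, hf | |].
  - now rewrite len_take, len_restr.
  - rewrite len_take; intros i hi. rewrite ent_take, !ent_restr; auto. ord.
Qed.

Lemma take_app s m k : k <= len s -> take (app s m) k = take s k.
Proof.
  intro h; apply Seq_ext; [apply Seq_take | apply Seq_take | |].
  - now rewrite !len_take.
  - rewrite len_take; intros i hi; rewrite !ent_take, ent_app; auto. ord.
Qed.

Lemma take_len s : Seq s -> take s (len s) = s.
Proof.
  intro h; apply Seq_ext; [apply Seq_take | exact h | apply len_take |].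
  rewrite len_take; intros i hi; now apply ent_take.
Qed.

Lemma restr_succ f n : DF1 f -> restr f (n + 1) = app (restr f n) (f n).
Proof.
  intro hf; apply Seq_ext; [apply Seq_restr, hf | apply Seq_app | |].
  - now rewrite len_app, !len_restr.
  - rewrite len_restr by exact hf; intros i hi. rewrite ent_restr by auto.
    apply lt_succ in hi; destruct hi as [hi | ->].
    + rewrite ent_app, ent_restr; auto. now rewrite len_restr.
    + pose proof (ent_app_last (restr f n) (f n)) as E.
      rewrite len_restr in E by exact hf; now rewrite E.
Qed.

End Sequences.
#[export] Hint Resolve DR2_divides DF2_modulus DF1_len DF2_ent DR1_Seq DF2_take DF2_app : defs.

Ltac defn_extra ::=
  lazymatch goal with
  | |- TDef (fun X e => mu _) => apply TDef_mu
  | |- TDef (fun X e => ite _ _ _) => apply TDef_ite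
  | |- TDef (fun X e => restr _ _) => apply TDef_restr
  end.

(** * Leftmost paths *)

Section Paths.
Context {M : L2_structure} {hM : model M}.
Local Open Scope L2_scope.
Notation N := (num M).

Definition leftmost (G : N -> Prop) (s : N) : Prop :=
  Seq s /\ forall k, k < len s -> least (fun m => G (app (take s k) m)) (ent s k).

Lemma leftmost_agree G s t : leftmost G s -> leftmost G t ->
  forall k, k < len s -> k < len t -> ent s k = ent t k.
Proof.
  intros [hs ks] [ht kt].
  apply (@strong_induction M hM
    (fun k => k < len s -> k < len t -> ent s k = ent t k)); [defn|].
  intros k IH h1 h2.
  assert (take s k = take t k) as E.
  { apply Seq_ext; [apply Seq_take | apply Seq_take | now rewrite !len_take |].
    rewrite len_take; intros i hi; rewrite !ent_take by exact hi.
    apply IH; ord. }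
  specialize (ks k h1); specialize (kt k h2); rewrite E in ks.
  exact (least_unique ks kt).
Qed.

Lemma leftmost_restr G f : DF1 f ->
  (forall k, least (fun m => G (app (restr f k) m)) (f k)) ->
  forall n, leftmost G (restr f n).
Proof.
  intros hf h n; split; [apply Seq_restr, hf|].
  rewrite len_restr by exact hf; intros k hk.
  rewrite take_restr, ent_restr by auto; apply h.
Qed.

(** Finite leftmost sequences are compatible with each other, so the entries of f can be read off
    from any long enough one. This defines f arithmetically from G alone, uniformly in G. *)
Lemma leftmost_path_entry G f : DF1 f ->
  (forall k, least (fun m => G (app (restr f k) m)) (f k)) ->
  forall k y, f k = y <-> exists s, leftmost G s /\ k < len s /\ ent s k = y.
Proof.
  intros hf h k y.
  assert (leftmost G (restr f (k + 1))) as L by now apply leftmost_restr.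
  split.
  - intros <-; exists (restr f (k + 1)); split; [exact L|].
    rewrite len_restr, ent_restr by (auto using lt_succ_diag); split; auto using lt_succ_diag.
  - intros (s & hs & ks & <-).
    rewrite <- (leftmost_agree L hs).
    + symmetry; apply ent_restr; auto using lt_succ_diag.
    + rewrite len_restr by auto; apply lt_succ_diag.
    + exact ks.
Qed.

(** Dependent choice with least choices. Arithmetical induction yields a leftmost sequence of every
    length inside G; since these agree with each other, their union is a function with an
    arithmetical graph. Most constructions of infinite sequences below are instances. *)
Lemma path_exists (G : N -> Prop) : sets G -> G emp ->
  (forall s, Seq s -> G s -> exists m, G (app s m)) ->
  exists f, DF1 f /\ forall n, G (restr f n).
Proof.
  intros hG h0 h.
  assert (forall n, exists s, leftmost G s /\ len s = n /\ G s) as H.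
  { unfold leftmost, least; apply induction; [defn | |].
    - exists emp; rewrite len_emp; repeat split; auto using Seq_emp;
        destruct (nlt0 H).
    - intros n (s & [hs ks] & hn & gs).
      destruct (@least_number M hM (fun m => G (app s m))) as (m & hm); [defn | auto |].
      exists (app s m); split; [split|split].
      + apply Seq_app.
      + rewrite len_app; intros k hk; apply lt_succ in hk; destruct hk as [hk | ->].
        * rewrite take_app, ent_app by auto. apply ks, hk.
        * rewrite take_app, take_len, ent_app_last by auto. exact hm.
      + rewrite len_app; congruence.
      + apply hm. }
  pose (f := fun k => mu (fun y => exists s, leftmost G s /\ k < len s /\ ent s k = y)).
  assert (DF1 f) as hf by (unfold f, leftmost, least; defn).
  exists f; split; [exact hf|]. intro n.
  destruct (H n) as (s & hs & hn & gs).
  replace (restr f n) with s; [exact gs|].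
  apply Seq_ext; [apply hs | apply Seq_restr, hf | now rewrite len_restr |].
  rewrite hn; intros i hi; rewrite ent_restr by auto. symmetry.
  unfold f; apply mu_eq; [unfold leftmost, least; defn|].
  split; [exists s; subst n; auto|].
  intros y hy (t & ht & kt & <-).
  subst n; rewrite <- (leftmost_agree hs ht hi kt) in hy; exact (lt_irrefl hy).
Qed.

End Paths.

(** * Functions and well-orders *)

Section WellOrders.
Context {M : L2_structure} {hM : model M}.
Local Open Scope L2_scope.
Notation N := (num M).

Definition graph_on (A : N -> Prop) (f : N -> N) (z : N) : Prop :=
  exists x, A x /\ z = pair x (f x).

Lemma coded_graph_on A f (x y : N) : coded (graph_on A f) x y <-> A x /\ y = f x.
Proof.
  split.
  - intros (x' & h & k); apply pair_inj in k; destruct k as [-> ->]; auto.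
  - intros [h ->]; exists x; auto.
Qed.

Lemma sets_graph_on A f : sets A -> DF1 f -> sets (graph_on A f).
Proof. intros; unfold graph_on; defn. Qed.

Lemma is_function_graph_on (A B : N -> Prop) f :
  (forall x, A x -> B (f x)) -> is_function A B (graph_on A f).
Proof.
  intro h; split.
  - intros z (x & hx & ->); eauto 6.
  - intros x hx; exists (f x); split; [now apply coded_graph_on|].
    intros y hy; apply coded_graph_on in hy; symmetry; apply hy.
Qed.

Definition value (F : N -> Prop) (x : N) : N := mu (fun y => coded F x y).

Lemma DF1_value F : sets F -> DF1 (value F).
Proof. intro h; unfold value, coded; defn. Qed.

Lemma coded_value (A B F : N -> Prop) x : sets F -> is_function A B F -> A x ->
  coded F x (value F x).
Proof.
  intros hF [h1 h2] hx. apply (@mu_spec M hM (fun y => coded F x y)); [unfold coded; defn|].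
  destruct (h2 x hx) as (y & hy & _); eauto.
Qed.

Lemma value_in (A B F : N -> Prop) x : sets F -> is_function A B F -> A x -> B (value F x).
Proof.
  intros hF h hx; pose proof (coded_value hF h hx) as k.
  destruct (proj1 h _ k) as (x' & y & e & _ & hy).
  apply pair_inj in e; destruct e as [_ ->]; exact hy.
Qed.

Lemma DR2_coded L : sets L -> DR2 (@coded M L).
Proof. intro h; unfold coded; defn. Qed.
Lemma DR2_strict L : sets L -> DR2 (@strict M L).
Proof. intro h; unfold strict, coded; defn. Qed.

Lemma strict_trans (W L : N -> Prop) x y z : partial_order W L ->
  strict L x y -> strict L y z -> strict L x z.
Proof.
  intros h [a b] [c d]; split; [exact (po_trans h a c)|].
  intro e; apply b. exact (po_trans h c e).
Qed.

Lemma coded_dom (W L : N -> Prop) x y : partial_order W L -> coded L x y -> W x /\ W y.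
Proof.
  intros h k; destruct (po_sub h k) as (x' & y' & e & hx & hy).
  apply pair_inj in e; destruct e as [-> ->]; auto.
Qed.

(** If every element of A had a smaller one in A, [path_exists] would string them into a descending
    sequence that belongs to the structure. *)
Lemma well_order_least (W L A : N -> Prop) : sets W -> sets L -> well_order W L ->
  sets A -> (forall x, A x -> W x) -> (exists x, A x) ->
  exists x, A x /\ forall y, A y -> ~ strict L y x.
Proof.
  intros hW hL [hlin hwo] hA hAW [x0 hx0]. pose proof (DR2_strict hL) as dS.
  apply NNPP; intro no.
  assert (forall x, A x -> exists y, A y /\ strict L y x) as step.
  { intros x hx; apply NNPP; intro k; apply no; exists x; split; [exact hx|].
    intros y hy hyx; apply k; eauto. }
  destruct (@path_exists M hM (fun s => (forall i, i < len s -> A (ent s i)) /\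
      forall i, i + 1 < len s -> strict L (ent s (i + 1)) (ent s i))) as (f & hf & k).
  - defn.
  - rewrite len_emp; split; intros i hi; destruct (nlt0 hi).
  - intros s hs [k1 k2].
    destruct (zero_or_succ (len s)) as [e | [n e]].
    + exists x0; rewrite len_app, e; split; intros i hi.
      * apply lt_succ in hi; destruct hi as [hi | ->]; [destruct (nlt0 hi)|].
        rewrite <- e; rewrite ent_app_last; exact hx0.
      * exfalso; ord.
    + destruct (step (ent s n)) as (y & hy & hyn); [apply k1; rewrite e; ord|].
      exists y; rewrite len_app; split; intros i hi.
      * apply lt_succ in hi; destruct hi as [hi | ->];
          [rewrite ent_app by exact hi; auto | rewrite ent_app_last; exact hy].
      * apply lt_succ in hi; destruct hi as [hi | hi].
        -- rewrite !ent_app by ord; auto.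
        -- rewrite hi, ent_app_last, ent_app by ord.
           rewrite e in hi; apply add_cancel_r in hi; subst i; exact hyn.
  - apply hwo; exists (graph_on (fun _ => True) f); split; [|split].
    + apply sets_graph_on; [defn | exact hf].
    + apply is_function_graph_on; intros n _. apply hAW.
      rewrite <- (@ent_restr M hM f hf (n + 1)) by apply lt_succ_diag.
      apply k; rewrite len_restr by exact hf; apply lt_succ_diag.
    + intros n y y' h1 h2; apply coded_graph_on in h1, h2.
      destruct h1 as [_ ->], h2 as [_ ->].
      rewrite <- (@ent_restr M hM f hf (n + 1 + 1)) by apply lt_succ_diag.
      rewrite <- (@ent_restr M hM f hf (n + 1 + 1) n) by ord.
      apply k; rewrite len_restr by exact hf; apply lt_succ_diag.
Qed.

Lemma well_order_induction (W L phi : N -> Prop) : sets W -> sets L -> well_order W L ->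
  sets phi -> (forall j, W j -> (forall i, strict L i j -> phi i) -> phi j) ->
  forall j, W j -> phi j.
Proof.
  intros hW hL hwo hphi step j hj; apply NNPP; intro k.
  destruct (@well_order_least W L (fun x => W x /\ ~ phi x)) as (x & [hx nx] & mx); auto.
  - defn.
  - tauto.
  - eauto.
  - apply nx, step; [exact hx|]. intros i hi; apply NNPP; intro ni.
    apply (mx i); [split; [|exact ni] | exact hi].
    apply (coded_dom (proj1 (proj1 hwo)) (proj1 hi)).
Qed.

End WellOrders.
#[export] Hint Resolve DR2_coded DR2_strict DF1_value sets_graph_on : defs.

(** * The Kleene-Brouwer order *)

Section KleeneBrouwer.
Context {M : L2_structure} {hM : model M}.
Local Open Scope L2_scope.
Notation N := (num M).

Definition pre (s t : N) : Prop := len s <= len t /\ forall i, i < len s -> ent s i = ent t i.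
Definition lft (s t : N) : Prop :=
  exists i, i < len s /\ i < len t /\ (forall k, k < i -> ent s k = ent t k) /\ ent s i < ent t i.
Definition kb (s t : N) : Prop := pre t s \/ lft s t.

Lemma DR2_pre : DR2 pre. Proof. unfold pre; defn. Qed.
Lemma DR2_lft : DR2 lft. Proof. unfold lft; defn. Qed.
Hint Resolve DR2_pre DR2_lft : defs.
Lemma DR2_kb : DR2 kb. Proof. unfold kb; defn. Qed.
Hint Resolve DR2_kb : defs.

Lemma pre_refl s : pre s s.
Proof. split; auto. Qed.
Lemma pre_trans s t u : pre s t -> pre t u -> pre s u.
Proof.
  intros [h1 h2] [k1 k2]; split; [ord|]. intros i hi; rewrite h2 by exact hi.
  apply k2; ord.
Qed.
Lemma pre_antisym s t : Seq s -> Seq t -> pre s t -> pre t s -> s = t.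
Proof.
  intros hs ht [h1 h2] [k1 k2]; apply Seq_ext; auto. ord.
Qed.
Lemma pre_emp s : pre emp s.
Proof.
  split; rewrite len_emp; [apply le0n|]; intros i hi; destruct (nlt0 hi).
Qed.
Lemma take_pre s t : Seq s -> pre s t -> s = take t (len s).
Proof.
  intros hs [h1 h2]; apply Seq_ext; [exact hs | apply Seq_take | now rewrite len_take |].
  intros i hi; rewrite ent_take; auto.
Qed.
Lemma pre_app s m : pre s (app s m).
Proof.
  split; rewrite ?len_app; [left; apply lt_succ_diag|].
  intros i hi; symmetry; now apply ent_app.
Qed.
Lemma app_pre s t m : pre s t -> len s < len t -> ent t (len s) = m -> pre (app s m) t.
Proof.
  intros [h1 h2] h3 h4; split; rewrite len_app; [now apply lt_le_succ|].
  intros i hi; apply lt_succ in hi; destruct hi as [hi | ->].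
  - rewrite ent_app; auto.
  - now rewrite ent_app_last.
Qed.
Lemma seq_compare s t : pre s t \/ pre t s \/ lft s t \/ lft t s.
Proof.
  destruct (classic (exists i, i < len s /\ i < len t /\ ent s i <> ent t i)) as [h | h].
  - destruct (@least_number M hM (fun i => i < len s /\ i < len t /\ ent s i <> ent t i))
      as (i & (h1 & h2 & h3) & h4); [defn | exact h |].
    assert (forall k, k < i -> ent s k = ent t k) as E.
    { intros k hk; apply NNPP; intro n; apply (h4 k hk); repeat split; auto; ord. }
    apply neq_lt in h3; destruct h3 as [h3 | h3]; [do 2 right; left | do 3 right];
      exists i; repeat split; auto. intros; symmetry; auto.
  - assert (forall i, i < len s -> i < len t -> ent s i = ent t i) as E.
    { intros i h1 h2; apply NNPP; intro n; apply h; eauto. }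
    destruct (lt_total (len s) (len t)) as [k | [k | k]].
    + left; split; auto. intros; apply E; auto. ord.
    + left; split; auto. intros; apply E; auto. ord.
    + right; left; split; auto. intros; symmetry; apply E; auto. ord.
Qed.

Lemma lft_pre s t s' t' : lft s t -> pre s s' -> pre t t' -> lft s' t'.
Proof.
  intros (i & h1 & h2 & h3 & h4) [a1 a2] [b1 b2].
  exists i; repeat split; [ord | ord | |].
  - intros k hk; rewrite <- a2, <- b2 by ord; auto.
  - rewrite <- a2, <- b2 by auto; auto.
Qed.

Lemma lft_trans s t u : lft s t -> lft t u -> lft s u.
Proof.
  intros (i & h1 & h2 & h3 & h4) (j & k1 & k2 & k3 & k4).
  destruct (lt_total i j) as [l | [-> | l]].
  - exists i; repeat split; [auto | ord | | rewrite <- k3; auto].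
    intros k hk; rewrite h3 by auto; apply k3; ord.
  - exists j; repeat split; [auto | auto | | ord].
    intros k hk; rewrite h3 by auto; auto.
  - exists j; repeat split; [ord | auto | | rewrite h3; auto].
    intros k hk; rewrite h3 by ord; auto.
Qed.

Lemma lft_irrefl s : ~ lft s s.
Proof. intros (i & _ & _ & _ & h); exact (lt_irrefl h). Qed.
Lemma lft_asym s t : lft s t -> ~ lft t s.
Proof. intros h k; exact (lft_irrefl (lft_trans h k)). Qed.
Lemma lft_npre s t : lft s t -> ~ pre s t.
Proof. intros h k; exact (lft_irrefl (lft_pre h k (pre_refl t))). Qed.
Lemma kb_total s t : kb s t \/ kb t s.
Proof. unfold kb; destruct (seq_compare s t) as [h | [h | [h | h]]]; auto. Qed.

Lemma kb_antisym s t : Seq s -> Seq t -> kb s t -> kb t s -> s = t.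
Proof.
  intros hs ht [h | h] [k | k].
  - now apply pre_antisym.
  - destruct (lft_npre k h).
  - destruct (lft_npre h k).
  - destruct (lft_asym h k).
Qed.

Lemma kb_trans s t u : kb s t -> kb t u -> kb s u.
Proof.
  intros [h | h] [k | k].
  - left; exact (pre_trans k h).
  - right; exact (lft_pre k h (pre_refl u)).
  - destruct (seq_compare u s) as [l | [l | [l | l]]].
    + left; exact l.
    + destruct (lft_npre h (pre_trans l k)).
    + destruct (lft_asym h (lft_pre l k (pre_refl s))).
    + right; exact l.
  - right; exact (lft_trans h k).
Qed.

(** A node outside the cone of r is a proper prefix of r, hence above the whole cone, or it lies to
    the left or to the right of the whole cone. In no case is it between two members. *)
Lemma cone_convex r s t u : pre r s -> pre r t -> kb s u -> kb u t -> pre r u.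
Proof.
  intros hs ht h k.
  destruct (seq_compare r u) as [l | [l | [l | l]]].
  - exact l.
  - destruct k as [k | k]; [exact (pre_trans ht k)|].
    destruct (lft_npre k (pre_trans l ht)).
  - pose proof (lft_pre l ht (pre_refl u)) as l'.
    destruct k as [k | k]; [destruct (lft_npre l' k) | destruct (lft_asym l' k)].
  - pose proof (lft_pre l (pre_refl u) hs) as l'.
    destruct h as [h | h]; [destruct (lft_npre l' h) | destruct (lft_asym l' h)].
Qed.

Lemma kb_child r s t : pre r s -> pre r t -> len r < len s -> len r < len t -> kb s t ->
  ent s (len r) <= ent t (len r).
Proof.
  intros [a1 a2] [b1 b2] h1 h2 [[c1 c2] | (i & d1 & d2 & d3 & d4)].
  - right; symmetry; auto.
  - destruct (lt_total i (len r)) as [l | [-> | l]].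
    + rewrite <- a2, <- b2 in d4 by auto; destruct (lt_irrefl d4).
    + auto.
    + right; auto.
Qed.

Definition KB (T : N -> Prop) (z : N) : Prop := exists s t, z = pair s t /\ T s /\ T t /\ kb s t.

Lemma coded_KB T s t : coded (KB T) s t <-> T s /\ T t /\ kb s t.
Proof.
  split.
  - intros (s' & t' & e & h); apply pair_inj in e; destruct e as [-> ->]; exact h.
  - intro h; exists s, t; auto.
Qed.

Lemma sets_KB T : sets T -> sets (KB T).
Proof. intro h; unfold KB; defn. Qed.

Definition tree (T : N -> Prop) : Prop :=
  (forall s, T s -> Seq s) /\ forall s k, T s -> k <= len s -> T (take s k).

Definition is_path (T : N -> Prop) (f : N -> N) : Prop := DF1 f /\ forall n, T (restr f n).

Lemma KB_linear T : tree T -> linear_order T (KB T).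
Proof.
  intros [h _]; split; [split|].
  - intros z (s & t & -> & hs & ht & _); eauto.
  - intros s hs; apply coded_KB; repeat split; auto. left; apply pre_refl.
  - intros s t a b; apply coded_KB in a, b; apply kb_antisym; try apply h; tauto.
  - intros s t u a b; apply coded_KB in a, b; apply coded_KB; repeat split; try tauto.
    apply kb_trans with t; tauto.
  - intros s t hs ht; rewrite !coded_KB; destruct (kb_total s t); auto.
Qed.

Lemma KB_strict T s t : tree T -> T s -> T t -> kb s t -> s <> t -> strict (KB T) s t.
Proof.
  intros h hs ht k n; split; rewrite coded_KB; auto.
  intros (_ & _ & k'); apply n; apply kb_antisym; auto; now apply (proj1 h).
Qed.

Lemma strict_KB T s t : tree T -> strict (KB T) s t -> T s /\ T t /\ kb s t /\ s <> t.
Proof.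
  intros h [a b]; pose proof (proj1 (coded_KB T s t) a) as (hs & ht & k).
  repeat split; auto. intros ->; exact (b a).
Qed.

Lemma pre_len_lt s t : Seq s -> Seq t -> pre s t -> s <> t -> len s < len t.
Proof.
  intros hs ht h n; destruct (proj1 h) as [k | k]; [exact k|].
  destruct n; apply Seq_ext; auto. apply h.
Qed.

(** A descending sequence of nodes converges entry by entry. Once all later nodes extend s, their
    next entries form a nonincreasing sequence of numbers, which becomes constant; the limits of the
    entries form a path. *)
Lemma KB_well_order T : sets T -> tree T -> ~ (exists f, is_path T f) -> well_order T (KB T).
Proof.
  intros hT tT no; split; [now apply KB_linear|].
  intros (F & hF & hfun & hdesc); apply no; clear no.
  pose proof (sets_KB hT) as hL.
  pose (f := value F). assert (DF1 f) as hf by now apply DF1_value.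
  assert (forall n, T (f n)) as fT by (intro n; exact (value_in hF hfun I)).
  assert (forall n, strict (KB T) (f (n + 1)) (f n)) as fS.
  { intro n; apply hdesc with n; exact (coded_value hF hfun I). }
  assert (forall n m, n < m -> strict (KB T) (f m) (f n)) as fD.
  { intro n; apply (@induction M hM (fun m => n < m -> strict (KB T) (f m) (f n))); [defn | |].
    - intro h; destruct (nlt0 h).
    - intros m IH h; apply lt_succ in h; destruct h as [h | ->]; [|apply fS].
      apply (strict_trans (proj1 (KB_linear tT)) (fS m)); auto. }
  destruct (@path_exists M hM (fun s => Seq s /\ exists n0, forall n, n0 <= n -> pre s (f n)))
    as (g & hg & kg).
  - defn.
  - split; [apply Seq_emp|]. exists 0; intros; apply pre_emp.
  - intros s hs [_ [n0 hn]].
    (* If f n were s itself, it would be a prefix of f n0 and so not below f n0, against the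
       descent. *)
    assert (forall n, n0 < n -> len s < len (f n)) as L.
    { intros n h; apply pre_len_lt; auto; [now apply (proj1 tT)|].
      intros ->. destruct (strict_KB tT (fD _ _ h)) as (a & b & c & d).
      apply d, kb_antisym; auto; try (now apply (proj1 tT)). left; apply hn; auto. }
    (* The least next entry is attained at n1 and cannot increase afterwards, so it is the limit. *)
    destruct (@least_number M hM (fun m => exists n, n0 < n /\ m = ent (f n) (len s)))
      as (m & (n1 & h1 & ->) & h2); [defn | |].
    { exists (ent (f (n0 + 1)) (len s)), (n0 + 1); split; auto using lt_succ_diag. }
    exists (ent (f n1) (len s)); split; [apply Seq_app|].
    exists n1; intros n h. apply app_pre; [apply hn; ord | apply L; ord |].
    assert (~ ent (f n) (len s) < ent (f n1) (len s)) as A.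
    { intro k; apply (h2 _ k); exists n; split; auto; ord. }
    assert (ent (f n) (len s) <= ent (f n1) (len s)) as B.
    { apply kb_child; [apply hn; ord | apply hn; ord | apply L; ord | apply L; ord |].
      destruct h as [h | ->]; [apply (strict_KB tT (fD _ _ h)) | left; apply pre_refl]. }
    ord.
  - exists g; split; [exact hg|]. intro n; destruct (kg n) as [hs [n0 h]].
    specialize (h n0 (or_intror eq_refl)).
    rewrite (take_pre hs h); apply (proj2 tT); [apply fT | apply h].
Qed.

End KleeneBrouwer.
#[export] Hint Resolve DR2_pre DR2_lft DR2_kb sets_KB : defs.

(** * Rational numbers *)

Section Rationals.
Context {M : L2_structure} {hM : model M}.
Local Open Scope L2_scope.
Notation N := (num M).
Add Ring num_ring : (num_srt (M := M)).

Definition frac (a b c : N) : N := pair (pair a b) c.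

Lemma frac_inj (a b c a' b' c' : N) :
  frac a b c = frac a' b' c' -> a = a' /\ b = b' /\ c = c'.
Proof.
  intro h; apply pair_inj in h; destruct h as [h ->]; apply pair_inj in h; tauto.
Qed.

Lemma DR2_rat_le : DR2 (@rat_le M).
Proof. unfold rat_le, fraction; defn. Qed.
Hint Resolve DR2_rat_le : defs.
Lemma DR1_rational : DR1 (@rational M).
Proof. unfold rational, fraction; defn. Qed.

Lemma rat_le_frac (a b c a' b' c' : N) : 0 < c -> 0 < c' ->
  (rat_le (frac a b c) (frac a' b' c') <-> a * c' + b' * c <= a' * c + b * c').
Proof.
  intros hc hc'; split.
  - intros (x & y & z & x' & y' & z' & [h1 _] & [h2 _] & h).
    apply frac_inj in h1, h2.
    destruct h1 as (-> & -> & ->), h2 as (-> & -> & ->); exact h.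
  - intro h; unfold rat_le, fraction; repeat eexists; eauto.
Qed.

Lemma rat_le_fraction (p q : N) : rat_le p q ->
  exists a b c a' b' c', p = frac a b c /\ q = frac a' b' c' /\ 0 < c /\ 0 < c'.
Proof.
  intros (a & b & c & a' & b' & c' & [h1 h2] & [h3 h4] & _).
  exists a, b, c, a', b', c'; auto.
Qed.

Lemma rational_fraction (p : N) : rational p -> exists a b c, p = frac a b c /\ 0 < c.
Proof. intros [(a & b & c & h) _]; exists a, b, c; exact h. Qed.

Lemma rat_le_trans (p q r : N) : rat_le p q -> rat_le q r -> rat_le p r.
Proof.
  intros h k.
  destruct (rat_le_fraction h) as (a & b & c & a' & b' & c' & -> & -> & hc & hc').
  destruct (rat_le_fraction k) as (a0 & b0 & c0 & a'' & b'' & c'' & e & -> & hc0 & hc'').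
  apply frac_inj in e; destruct e as (<- & <- & <-).
  apply rat_le_frac in h; auto. apply rat_le_frac in k; auto. apply rat_le_frac; auto.
  (* Without subtraction: after multiplying by c' and adding a common term to both sides, the goal
     is the sum of the first hypothesis times c'' and the second times c. *)
  apply (mul_le_cancel hc').
  apply (@add_le_cancel _ _ _ _ (a' * c * c'' + b' * c * c'')).
  apply (@mul_le_mono _ _ _ _ c'') in h. apply (@mul_le_mono _ _ _ _ c) in k.
  pose proof (add_le_mono h k) as l.
  match type of l with ?x < ?y \/ _ => match goal with |- ?u < ?v \/ _ =>
    replace u with x by ring; replace v with y by ring end end.
  exact l.
Qed.

Lemma rat_le_total (p q : N) : rational p -> rational q -> rat_le p q \/ rat_le q p.
Proof.
  intros hp hq.
  destruct (rational_fraction hp) as (a & b & c & -> & hc).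
  destruct (rational_fraction hq) as (a' & b' & c' & -> & hc').
  rewrite !rat_le_frac by auto.
  destruct (lt_total (a * c' + b' * c) (a' * c + b * c')) as [h | [h | h]]; auto.
Qed.

Lemma rat_le_antisym (p q : N) : rational p -> rational q -> rat_le p q -> rat_le q p -> p = q.
Proof.
  intros [_ hp] [_ hq] h k; destruct (lt_total p q) as [l | [l | l]].
  - destruct (hq p l); auto.
  - exact l.
  - destruct (hp q l); auto.
Qed.

Lemma rat_le_refl (p : N) : rational p -> rat_le p p.
Proof. intro h; destruct (rat_le_total h h); auto. Qed.

Lemma rational_of_frac (a b c : N) : 0 < c ->
  exists r, rational r /\ rat_le r (frac a b c) /\ rat_le (frac a b c) r.
Proof.
  intro hc; set (q := frac a b c).
  assert (rat_le q q) as hq by (apply rat_le_frac; auto; right; ring).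
  destruct (@least_number M hM (fun r => rat_le r q /\ rat_le q r)) as (r & [h1 h2] & h3);
    [defn | eauto |].
  exists r; split; [|auto]; split.
  - destruct (rat_le_fraction h1) as (x & y & z & _ & _ & _ & -> & _ & hz & _).
    exists x, y, z; split; auto.
  - intros r' hr' [k1 k2]; apply (h3 r' hr'); split; eapply rat_le_trans; eauto.
Qed.

Definition rlt (p q : N) : Prop := rational p /\ rational q /\ ~ rat_le q p.

Lemma DR2_rlt : DR2 rlt.
Proof. unfold rlt; pose proof DR1_rational; defn. Qed.

Lemma rlt_le p q : rlt p q -> rat_le p q.
Proof. intros (hp & hq & h); destruct (rat_le_total hp hq); tauto. Qed.

Lemma rlt_irrefl p : ~ rlt p p.
Proof. intros (hp & _ & h); apply h, rat_le_refl, hp. Qed.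

Lemma rlt_trans p q r : rlt p q -> rlt q r -> rlt p r.
Proof.
  intros h k; pose proof (rlt_le h) as h'. destruct h as (hp & hq & h), k as (_ & hr & k).
  repeat split; try apply hp; try apply hr. intro l; apply k.
  eapply rat_le_trans; eauto.
Qed.

Lemma rlt_asym p q : rlt p q -> ~ rlt q p.
Proof. intros h k; exact (rlt_irrefl (rlt_trans h k)). Qed.

Lemma rlt_total p q : rational p -> rational q -> p = q \/ rlt p q \/ rlt q p.
Proof.
  intros hp hq.
  destruct (classic (rat_le p q)) as [h|h], (classic (rat_le q p)) as [k|k].
  - left; now apply rat_le_antisym.
  - right; left; repeat split; auto; apply hp || apply hq.
  - right; right; repeat split; auto; apply hp || apply hq.
  - destruct (rat_le_total hp hq); tauto.
Qed.

Lemma rat_le_iff p q : rational p -> rational q -> (rat_le p q <-> p = q \/ rlt p q).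
Proof.
  intros hp hq; split.
  - intro h; destruct (rlt_total hp hq) as [k | [k | k]]; auto.
    destruct k as (_ & _ & k); tauto.
  - intros [-> | h]; [now apply rat_le_refl | now apply rlt_le].
Qed.

Lemma rlt_dense p q : rlt p q -> exists r, rlt p r /\ rlt r q.
Proof.
  intros (hp & hq & h).
  destruct (rational_fraction hp) as (a & b & c & ep & hc).
  destruct (rational_fraction hq) as (a' & b' & c' & eq & hc').
  rewrite ep, eq, rat_le_frac in h by auto. apply not_le in h.
  assert (0 < (1 + 1) * (c * c')) as hm.
  { apply pos_mul; [apply lt_iff; exists 1; ring | now apply pos_mul]. }
  (* This fraction is the midpoint of p and q. *)
  destruct (@rational_of_frac (a * c' + a' * c) (b * c' + b' * c) ((1 + 1) * (c * c')))
    as (r & hr & k1 & k2); [exact hm|].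
  exists r; split; (split; [assumption|split; [assumption|]]); intro l.
  - pose proof (rat_le_trans k2 l) as m. rewrite ep, rat_le_frac in m by auto.
    assert (a' * c + b * c' <= a * c' + b' * c) as n; [|ord].
    apply (mul_le_cancel hc), (@add_le_cancel _ _ _ _ (a * c * c' + b * c * c')).
    match type of m with ?x < ?y \/ _ => match goal with |- ?u < ?v \/ _ =>
      replace u with x by ring; replace v with y by ring end end.
    exact m.
  - pose proof (rat_le_trans l k1) as m. rewrite eq, rat_le_frac in m by auto.
    assert (a' * c + b * c' <= a * c' + b' * c) as n; [|ord].
    apply (mul_le_cancel hc'), (@add_le_cancel _ _ _ _ (a' * c * c' + b' * c * c')).
    match type of m with ?x < ?y \/ _ => match goal with |- ?u < ?v \/ _ =>
      replace u with x by ring; replace v with y by ring end end.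
    exact m.
Qed.

Lemma rlt_exists : exists p q, rlt p q.
Proof.
  assert ((0 : N) < 1) as h1 by (apply lt_iff; exists 0; ring).
  destruct (@rational_of_frac 0 0 1 h1) as (p & hp & p1 & p2).
  destruct (@rational_of_frac 1 0 1 h1) as (q & hq & q1 & q2).
  exists p, q; repeat split; try apply hp; try apply hq. intro h.
  pose proof (rat_le_trans q2 (rat_le_trans h p1)) as k.
  apply rat_le_frac in k; auto.
  replace (1 * 1 + 0 * 1) with (0 + 1 : N) in k by ring.
  replace (0 * 1 + 0 * 1) with (0 : N) in k by ring. ord.
Qed.

End Rationals.
#[export] Hint Resolve DR2_rat_le DR1_rational DR2_rlt : defs.

(** * Trees with few paths *)

Section Scattered.
Context {M : L2_structure} {hM : model M}.
Local Open Scope L2_scope.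
Notation N := (num M).
Context (T : N -> Prop) (hT : sets T) (tT : tree T).

(** * Copies of the rationals inside a Kleene-Brouwer order *)

Section Embedding.
Context (f : N -> N) (hf : DF1 f) (fT : forall p, rational p -> T (f p))
  (f_mono : forall p q, rlt p q -> kb (f p) (f q) /\ f p <> f q).

(** The cone of s contains the images of both endpoints of a nondegenerate subinterval of [a, b],
    hence by [cone_convex] the images of everything between them. *)
Let good (a b s : N) : Prop := exists p q, rlt p q /\ (a = p \/ rlt a p) /\
  (q = b \/ rlt q b) /\ pre s (f p) /\ pre s (f q).

(** Among the images of the points strictly between p and q, take the least next entry after s,
    attained at r. Next entries are monotone along the order, so every point between p and r has
    this same entry, and a subinterval ending at r has both endpoints in one child cone. *)
Lemma dense_child a b s : Seq s -> good a b s -> exists m, good a b (app s m).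
Proof.
  intros hs (p & q & hpq & ha & hb & sp & sq).
  assert (forall r, rlt p r -> rlt r q -> pre s (f r)) as C.
  { intros r h1 h2; apply (cone_convex sp sq); [apply f_mono, h1 | apply f_mono, h2]. }
  (* A node is the largest element of its own cone, so f r = s would leave no room for f q above
     it. *)
  assert (forall r, rlt p r -> rlt r q -> len s < len (f r)) as L.
  { intros r h1 h2; apply pre_len_lt; auto; [apply (proj1 tT), fT, h1|].
    intros ->. destruct (f_mono h2) as [a1 a2]. apply a2, kb_antisym; auto.
    - apply (proj1 tT), fT, h2.
    - left; exact sq. }
  destruct (@least_number M hM (fun m => exists r, rlt p r /\ rlt r q /\ m = ent (f r) (len s)))
    as (m & (r & h1 & h2 & ->) & h3); [defn | |].
  { destruct (rlt_dense hpq) as (r & h1 & h2); eauto. }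
  destruct (rlt_dense h1) as (r' & k1 & k2).
  assert (rlt r' q) as k3 by exact (rlt_trans k2 h2).
  assert (ent (f r') (len s) = ent (f r) (len s)) as E.
  { assert (ent (f r') (len s) <= ent (f r) (len s)) as l.
    { apply kb_child; auto. apply f_mono, k2. }
    assert (~ ent (f r') (len s) < ent (f r) (len s)) as l' by (intro l'; apply (h3 _ l'); eauto).
    ord. }
  exists (ent (f r) (len s)), r', r; repeat split; try apply k2.
  - right; destruct ha as [-> | ha]; [exact k1 | exact (rlt_trans ha k1)].
  - right; destruct hb as [<- | hb]; [exact h2 | exact (rlt_trans h2 hb)].
  - rewrite len_app; apply lt_le_succ; auto.
  - apply app_pre; auto.
  - rewrite len_app; apply lt_le_succ; auto.
  - apply app_pre; auto.
Qed.

(** Iterates [dense_child], except that the first entry is prescribed to be j; at the empty sequence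
    the endpoints a and b themselves show that this choice is good. *)
Lemma dense_path a b j : rlt a b -> pre (app emp j) (f a) -> pre (app emp j) (f b) ->
  exists g, is_path T g /\ g 0 = j /\ forall n, good a b (restr g n).
Proof.
  intros hab ja jb.
  destruct (@path_exists M hM (fun s => Seq s /\ good a b s /\ (0 < len s -> ent s 0 = j)))
    as (g & hg & k).
  - unfold good; defn.
  - split; [apply Seq_emp|split].
    + exists a, b; repeat split; auto using pre_emp; try apply hab; apply pre_emp.
    + rewrite len_emp; intro h; destruct (nlt0 h).
  - intros s hs (_ & gs & sj).
    destruct (zero_or_succ (len s)) as [e | [n e]].
    + assert (s = emp) as ->.
      { apply Seq_ext; auto using Seq_emp; rewrite e; [now rewrite len_emp|].
        intros i hi; destruct (nlt0 hi). }
      exists j; split; [apply Seq_app|split].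
      * exists a, b; auto 6.
      * intros _. rewrite <- len_emp; apply ent_app_last.
    + destruct (dense_child hs gs) as [m hm].
      exists m; split; [apply Seq_app|split; [exact hm|]].
      intros _; assert (0 < len s) as l by (rewrite e; apply lt_succ, le0n).
      rewrite ent_app; auto.
  - exists g; split; [split; [exact hg|]|split].
    + intro n; destruct (k n) as (h1 & (p & q & h2 & _ & _ & h3 & _) & _).
      rewrite (take_pre h1 h3); apply (proj2 tT); [apply fT, h2 | apply h3].
    + destruct (k 1) as (_ & _ & h).
      assert ((0 : N) < 1) as l by (rewrite <- (add0 1); apply lt_succ_diag).
      rewrite len_restr, ent_restr in h; auto.
    + intro n; apply k.
Qed.

Lemma dense_two_paths :
  ~ (forall f g, is_path T f -> is_path T g -> f 0 = g 0 -> forall n, f n = g n).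
Proof.
  intro uniq.
  destruct rlt_exists as (p0 & q0 & h0).
  destruct (@dense_child p0 q0 emp Seq_emp) as (j & p & q & hpq & _ & _ & jp & jq).
  { exists p0, q0; auto 6 using pre_emp. }
  destruct (rlt_dense hpq) as (r1 & h1 & h1').
  destruct (rlt_dense h1') as (r2 & h2 & h2').
  assert (forall r, rlt p r -> rlt r q -> pre (app emp j) (f r)) as C.
  { intros r l1 l2; apply (cone_convex jp jq); [apply f_mono, l1 | apply f_mono, l2]. }
  destruct (@dense_path p r1 j) as (g1 & P1 & z1 & G1); auto.
  destruct (@dense_path r2 q j) as (g2 & P2 & z2 & G2); auto.
  { apply C; [exact (rlt_trans h1 h2) | exact h2']. }
  assert (g1 = g2) as <-.
  { apply functional_extensionality; apply uniq; congruence. }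
  (* The common path is cut at a length exceeding that of f r1. This segment is a prefix of an image
     below f r1 and of one above it, hence by convexity of f r1, which is too short. *)
  destruct (G1 (len (f r1) + 1)) as (p' & q' & l & _ & l' & k & _).
  destruct (G2 (len (f r1) + 1)) as (p'' & q'' & m & m' & _ & k' & _).
  assert (rlt p' r1) as A by (destruct l' as [<- | l']; [exact l | exact (rlt_trans l l')]).
  assert (rlt r1 p'') as B by (destruct m' as [<- | m']; [exact h2 | exact (rlt_trans h2 m')]).
  destruct (cone_convex k k' (proj1 (f_mono A)) (proj1 (f_mono B))) as [n _].
  rewrite len_restr in n by apply P1. ord.
Qed.
End Embedding.

Lemma KB_scattered :
  (forall f g, is_path T f -> is_path T g -> f 0 = g 0 -> forall n, f n = g n) ->
  scattered T (KB T).
Proof.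
  intros uniq (F & hF & hfun & hemb).
  refine (@dense_two_paths (value F) (DF1_value hF) _ _ uniq).
  - intros p hp; exact (value_in hF hfun hp).
  - intros p q h.
    assert (coded F p (value F p)) as A by (apply (coded_value hF hfun), h).
    assert (coded F q (value F q)) as B by (apply (coded_value hF hfun), h).
    pose proof (proj1 (hemb _ _ _ _ A B) (rlt_le h)) as K.
    apply coded_KB in K; split; [tauto|]. intro e.
    destruct h as (_ & _ & h); apply h, (hemb _ _ _ _ B A). rewrite e.
    apply coded_KB; split; [apply K|split; [apply K | left; apply pre_refl]].
Qed.

(* A path is the leftmost path of the complement of the initial interval of the
   nodes to its left, hence it can be read off this interval. *)
Lemma paths_enumerable : countably_many_initial_intervals T (KB T) ->
  exists Z : N -> N -> N -> Prop, DR3 Z /\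
    forall f, is_path T f -> exists n, forall k y, Z n k y <-> f k = y.
Proof.
  intros (Z & hZ & h).
  exists (fun n k y => exists s, leftmost (fun s => T s /\ ~ slice Z n s) s /\
    k < len s /\ ent s k = y).
  split; [unfold leftmost, least, slice, coded; defn|].
  intros f [hf fT].
  pose (I := fun s => T s /\ exists i, i < len s /\ (forall k, k < i -> ent s k = f k)
    /\ ent s i < f i).
  destruct (h I) as [n hn].
  - unfold I; defn.
  - split; [intros s hs; apply hs|].
    intros s t st (ht & i & h1 & h2 & h3). apply coded_KB in st; destruct st as (hs & _ & st).
    split; [exact hs|]. destruct st as [[a b] | (j & a & b & c & d)].
    + exists i; repeat split; [ord | | rewrite <- b; auto].
      intros k hk; rewrite <- b by ord; auto.
    + destruct (lt_total i j) as [l | [-> | l]].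
      * exists i; repeat split; [ord | | rewrite c; auto]. intros k hk; rewrite c by ord; auto.
      * exists j; repeat split; [auto | | ord]. intros k hk; rewrite c; auto.
      * exists j; repeat split; [auto | | rewrite <- h2; auto].
        intros k hk; rewrite c by ord; apply h2; ord.
  - exists n; intros k y; symmetry.
    apply (@leftmost_path_entry M hM (fun s => T s /\ ~ slice Z n s) f hf). clear k y.
    intro k; split; [split|].
    + rewrite <- restr_succ by auto; apply fT.
    + rewrite <- restr_succ by auto. intro K; apply hn in K.
      destruct K as (_ & i & h1 & _ & h3). rewrite len_restr in h1 by auto.
      rewrite ent_restr in h3 by auto; exact (lt_irrefl h3).
    + intros m hm [Tm K]; apply K, hn; split; [exact Tm|].
      exists k. rewrite len_app, len_restr by auto. split; [ord|split].
      * intros i hi; rewrite ent_app, ent_restr; auto; rewrite len_restr; auto.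
      * pose proof (ent_app_last (restr f k) m) as E. rewrite len_restr in E by auto.
        rewrite E; exact hm.
Qed.

End Scattered.

(** * Arithmetical relations as closed relations with unique Skolem functions *)

Section Satisfaction.
Context {M : L2_structure} {hM : model M}.
Local Open Scope L2_scope.
Notation N := (num M).
Notation env := (nat -> num M).

Lemma TDef_eval (v : (N -> Prop) -> env -> env) t :
  (forall i, TDef (fun X e => v X e i)) -> TDef (fun X e => eval (v X e) t).
Proof.
  intro h; induction t; simpl; [apply h | | | |]; defn; auto.
Qed.

(** Set variable 0 may be interpreted by a defined set that varies with the number variables, such
    as [below L Y j]; induction on the formula inserts its definition at the atoms. *)
Lemma Def_sat (E : nat -> N -> Prop) : (forall k, sets (E k)) ->
  forall p (v : (N -> Prop) -> env -> env) (Y : (N -> Prop) -> env -> N -> Prop),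
  (forall i, TDef (fun X e => v X e i)) ->
  Def (fun X e => Y X (fun i => e (S i)) (e O)) ->
  Def (fun X e => sat (v X e) (scons (Y X e) E) p).
Proof.
  intros hE p; induction p; intros v Y hv hY; simpl.
  - apply Def_R2; [apply DR2_eq | now apply TDef_eval | now apply TDef_eval].
  - apply Def_R2; [apply DR2_lt | now apply TDef_eval | now apply TDef_eval].
  - destruct k as [|k]; simpl.
    + apply (Def_subst1 hY); now apply TDef_eval.
    + apply Def_R1; [apply DR1_sets, hE | now apply TDef_eval].
  - apply Def_not; auto.
  - apply Def_and; auto.
  - apply Def_or; auto.
  - apply Def_imp; auto.
  - apply Def_all.
    apply (IHp (fun X e => scons (e O) (v X (fun i => e (S i)))) (fun X e => Y X (fun i => e (S i)))).
    + intros [|i]; simpl; [apply TDef_var | exact (TDef_ren S (hv i))].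
    + exact (Def_ren (fun i => match i with O => O | S i => S (S i) end) hY).
  - apply Def_ex.
    apply (IHp (fun X e => scons (e O) (v X (fun i => e (S i)))) (fun X e => Y X (fun i => e (S i)))).
    + intros [|i]; simpl; [apply TDef_var | exact (TDef_ren S (hv i))].
    + exact (Def_ren (fun i => match i with O => O | S i => S (S i) end) hY).
Qed.

(** A single number, read as an iterated pair, supplies values for all number variables. Each
    formula thereby becomes a unary predicate, and binding a variable becomes pairing
    ([scons_env_of]). *)
Fixpoint component (i : nat) (x : N) : N :=
  match i with O => fst x | S i => component i (snd x) end.
Definition env_of (x : N) : env := fun i => component i x.

Lemma scons_env_of a x : scons a (env_of x) = env_of (pair a x).
Proof.
  apply functional_extensionality; intros [|i]; unfold env_of; simpl;
    [now rewrite fst_pair | now rewrite snd_pair].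
Qed.

Lemma DF1_component i : DF1 (component i).
Proof.
  induction i; simpl; defn.
Qed.

Lemma DF1_eval t : DF1 (fun x => eval (env_of x) t).
Proof. apply (TDef_eval (v := fun X e => env_of (e O))); exact DF1_component. Qed.

(** Closed sets of Baire space in the sense of the structure: membership is tested on all finite
    initial segments by one set. *)
Definition closed (C : (N -> N) -> Prop) : Prop :=
  exists K, sets K /\ forall h, DF1 h -> (C h <-> forall n, K (restr h n)).

Lemma closed_iff C C' : (forall h, C h <-> C' h) -> closed C -> closed C'.
Proof.
  intros h (K & hK & k); exists K; split; [exact hK|]; intros f hf; rewrite <- h; auto.
Qed.

Lemma closed_and C C' : closed C -> closed C' -> closed (fun h => C h /\ C' h).
Proof.
  intros (K & hK & k) (K' & hK' & k'); exists (fun s => K s /\ K' s); split; [defn|].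
  intros h hh; rewrite k, k' by auto; split;
    [intros [a b] n; auto | intro a; split; intro n; apply a].
Qed.

(** The instance at k reads h at three positions computed from k alone. An initial segment is tested
    only for those k whose positions it covers, and a long enough one covers any given k. *)
Lemma closed_local Q t1 t2 t3 : DR4 Q -> DF1 t1 -> DF1 t2 -> DF1 t3 ->
  closed (fun h => forall k, Q k (h (t1 k)) (h (t2 k)) (h (t3 k))).
Proof.
  intros hQ h1 h2 h3.
  exists (fun s => forall k, t1 k < len s -> t2 k < len s -> t3 k < len s ->
    Q k (ent s (t1 k)) (ent s (t2 k)) (ent s (t3 k))).
  split; [defn|].
  intros h hh; split.
  - intros H n k; rewrite len_restr by auto; intros l1 l2 l3.
    rewrite !ent_restr by auto; apply H.
  - intros H k. set (n := t1 k + t2 k + t3 k + 1).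
    assert (t1 k < n) as l1.
    { apply lt_iff; exists (t2 k + t3 k); unfold n; now rewrite addA. }
    assert (t2 k < n) as l2.
    { apply lt_iff; exists (t1 k + t3 k); unfold n; rewrite (addC (t1 k) (t2 k)), <- !addA; auto. }
    assert (t3 k < n) as l3.
    { apply lt_iff; exists (t1 k + t2 k); unfold n; rewrite (addC (t3 k)); auto. }
    specialize (H n k); rewrite len_restr, !ent_restr in H by auto; auto.
Qed.

Lemma take_take (s n m : N) : m <= n -> take (take s n) m = take s m.
Proof. intro h; apply take_restr; [apply DF1_ent | exact h]. Qed.

(** Demanding the test set at every prefix makes it a tree without changing the functions that
    pass. *)
Lemma closed_tree C : closed C -> exists T, sets T /\ tree T /\
  forall h, DF1 h -> (C h <-> is_path T h).
Proof.
  intros (K & hK & k). exists (fun s => Seq s /\ forall n, n <= len s -> K (take s n)).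
  split; [defn|split; [split|]].
  - tauto.
  - intros s n [hs h] hn; split; [apply Seq_take|]. rewrite len_take; intros m hm.
    rewrite take_take by exact hm; apply h; ord.
  - intros h hh; rewrite k by auto; split.
    + intro H; split; [exact hh|]. intro n; split; [now apply Seq_restr|].
      rewrite len_restr by auto; intros m hm; rewrite take_restr; auto.
    + intros [_ H] n; destruct (H n) as [_ h']. specialize (h' n).
      rewrite len_restr, take_restr in h' by auto; auto.
Qed.

End Satisfaction.

(** * Canonical Skolem functions of an arithmetical formula *)

Section Skolem.
Context {M : L2_structure} {hM : model M}.
Local Open Scope L2_scope.
Notation N := (num M).
Context (E : nat -> N -> Prop) (hE : forall k, sets (E k)).

Definition bv (A : Prop) : N := ite A 1 0.

Lemma one_neq0 : (1 : N) <> 0.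
Proof. rewrite <- (add0 1); apply neq_succ0. Qed.

Lemma bv_neq0 A : bv A <> 0 <-> A.
Proof.
  unfold bv; destruct (classic A) as [h|h]; [rewrite ite_true by exact h
    | rewrite ite_false by exact h]; pose proof one_neq0; tauto.
Qed.

Lemma bv_iff A B : (A <-> B) -> bv A = bv B.
Proof. intro h; f_equal; now apply propositional_extensionality. Qed.

(* The Skolem function of a quantifier takes the value 0 if there is no witness and
   1 + the least witness otherwise; for a universal quantifier the witnesses are
   counterexamples, so there 0 stands for truth. *)
Definition tv (p : arith) (u : N) : Prop :=
  match p with fall _ => u = 0 | _ => u <> 0 end.

(** One instance, for the candidate b, of the condition on a Skolem value u. Together over all b the
    instances say that u is 0 or one more than the least witness, while each instance inspects a
    single candidate and is therefore a local condition. *)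
Definition wit (b u : N) (A : Prop) : Prop :=
  (u = 0 -> ~ A) /\ (u = b + 1 -> A) /\ (forall c, u = c + 1 -> b < c -> ~ A).

Lemma wit_unique u u' (A : N -> Prop) :
  (forall b, wit b u (A b)) -> (forall b, wit b u' (A b)) -> u = u'.
Proof.
  intros h h'.
  destruct (zero_or_succ u) as [-> | [c ->]], (zero_or_succ u') as [-> | [c' ->]].
  - reflexivity.
  - destruct (proj1 (h c') eq_refl). now apply (h' c').
  - destruct (proj1 (h' c) eq_refl). now apply (h c).
  - destruct (lt_total c c') as [l | [-> | l]]; [exfalso | reflexivity | exfalso].
    + apply (proj2 (proj2 (h' c)) c' eq_refl l); now apply (h c).
    + apply (proj2 (proj2 (h c')) c eq_refl l); now apply (h' c').
Qed.

Lemma wit_ex u (A : N -> Prop) : (forall b, wit b u (A b)) -> (u <> 0 <-> exists b, A b).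
Proof.
  intro h; split.
  - intro k; destruct (zero_or_succ u) as [-> | [c ->]]; [tauto|].
    exists c; now apply (h c).
  - intros [b hb] ->; now apply (proj1 (h b)).
Qed.

Definition sk (A : N -> Prop) : N := ite (exists b, A b) (mu A + 1) 0.

Lemma sk_wit A : sets A -> forall b, wit b (sk A) (A b).
Proof.
  intros hA b; unfold sk; destruct (classic (exists b, A b)) as [h|h].
  - rewrite ite_true by exact h. destruct (mu_cases hA) as [[k l] | [_ k]].
    + split; [|split].
      * intro e; destruct (neq_succ0 e).
      * intro e; apply add_cancel_r in e; subst b; exact k.
      * intros c e hb; apply add_cancel_r in e; subst c; auto.
    + destruct h as [x hx]; destruct (k x hx).
  - rewrite ite_false by exact h. split; [|split].
    + intros _ hb; apply h; eauto.
    + intro e; destruct (neq_succ0 (eq_sym e)).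
    + intros c e; destruct (neq_succ0 (eq_sym e)).
Qed.

(* [G l] is the Skolem function of the subformula at the address [l]. *)
Fixpoint cond (X : N -> Prop) (p : arith) (G : list bool -> N -> N) : Prop :=
  match p with
  | fnot p => cond X p (fun l => G (false :: l)) /\
      forall x, G [] x = bv (~ tv p (G [false] x))
  | fand p q => (cond X p (fun l => G (false :: l)) /\ cond X q (fun l => G (true :: l))) /\
      forall x, G [] x = bv (tv p (G [false] x) /\ tv q (G [true] x))
  | f_or p q => (cond X p (fun l => G (false :: l)) /\ cond X q (fun l => G (true :: l))) /\
      forall x, G [] x = bv (tv p (G [false] x) \/ tv q (G [true] x))
  | fimp p q => (cond X p (fun l => G (false :: l)) /\ cond X q (fun l => G (true :: l))) /\
      forall x, G [] x = bv (tv p (G [false] x) -> tv q (G [true] x))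
  | fex p => cond X p (fun l => G (false :: l)) /\
      forall x b, wit b (G [] x) (tv p (G [false] (pair b x)))
  | fall p => cond X p (fun l => G (false :: l)) /\
      forall x b, wit b (G [] x) (~ tv p (G [false] (pair b x)))
  | p => forall x, G [] x = bv (sat (env_of x) (scons X E) p)
  end.

Lemma cond_correct X p : forall G, cond X p G ->
  forall x, tv p (G [] x) <-> sat (env_of x) (scons X E) p.
Proof.
  induction p; intros G h x; simpl in *.
  - rewrite h; apply bv_neq0.
  - rewrite h; apply bv_neq0.
  - rewrite h; apply bv_neq0.
  - destruct h as [h ->]; rewrite bv_neq0. now rewrite (IHp _ h).
  - destruct h as [[h k] ->]; rewrite bv_neq0. now rewrite (IHp1 _ h), (IHp2 _ k).
  - destruct h as [[h k] ->]; rewrite bv_neq0. now rewrite (IHp1 _ h), (IHp2 _ k).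
  - destruct h as [[h k] ->]; rewrite bv_neq0. now rewrite (IHp1 _ h), (IHp2 _ k).
  - destruct h as [h k]. pose proof (wit_ex (k x)) as w. split.
    + intros e a; rewrite scons_env_of; apply (IHp _ h). apply NNPP; intro n.
      apply (proj2 w); eauto.
    + intro l; apply NNPP; intro n; apply w in n; destruct n as [b hb]; apply hb.
      apply (IHp _ h); rewrite <- scons_env_of; apply l.
  - destruct h as [h k]. rewrite (wit_ex (k x)).
    split; intros [b hb]; exists b; [rewrite scons_env_of; apply (IHp _ h), hb|].
    apply (IHp _ h); rewrite <- scons_env_of; apply hb.
Qed.

Fixpoint used (p : arith) : list (list bool) :=
  [] :: match p with
  | fnot p | fall p | fex p => map (cons false) (used p)
  | fand p q | f_or p q | fimp p q => map (cons false) (used p) ++ map (cons true) (used q)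
  | _ => []
  end.

(** By [cond_correct] the truth values of subformulas depend on X only, and least witnesses are
    unique. An arbitrary choice of witnesses would give several paths for the same X. *)
Lemma cond_unique X p : forall G G', cond X p G -> cond X p G' ->
  forall l, In l (used p) -> forall x, G l x = G' l x.
Proof.
  induction p; intros G G' h h' l hl x; simpl in *;
    try (destruct hl as [<- | []]; rewrite h, h'; reflexivity).
  - destruct h as [h k], h' as [h' k'].
    destruct hl as [<- | hl].
    + rewrite k, k'; apply bv_iff. now rewrite (cond_correct h), (cond_correct h').
    + apply in_map_iff in hl; destruct hl as (l' & <- & hl). exact (IHp _ _ h h' l' hl x).
  - destruct h as [[h1 h2] k], h' as [[h1' h2'] k'].
    destruct hl as [<- | hl].
    + rewrite k, k'; apply bv_iff.
      now rewrite (cond_correct h1), (cond_correct h1'), (cond_correct h2), (cond_correct h2').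
    + apply in_app_or in hl; destruct hl as [hl | hl]; apply in_map_iff in hl;
        destruct hl as (l' & <- & hl); [exact (IHp1 _ _ h1 h1' l' hl x) | exact (IHp2 _ _ h2 h2' l' hl x)].
  - destruct h as [[h1 h2] k], h' as [[h1' h2'] k'].
    destruct hl as [<- | hl].
    + rewrite k, k'; apply bv_iff.
      now rewrite (cond_correct h1), (cond_correct h1'), (cond_correct h2), (cond_correct h2').
    + apply in_app_or in hl; destruct hl as [hl | hl]; apply in_map_iff in hl;
        destruct hl as (l' & <- & hl); [exact (IHp1 _ _ h1 h1' l' hl x) | exact (IHp2 _ _ h2 h2' l' hl x)].
  - destruct h as [[h1 h2] k], h' as [[h1' h2'] k'].
    destruct hl as [<- | hl].
    + rewrite k, k'; apply bv_iff.
      now rewrite (cond_correct h1), (cond_correct h1'), (cond_correct h2), (cond_correct h2').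
    + apply in_app_or in hl; destruct hl as [hl | hl]; apply in_map_iff in hl;
        destruct hl as (l' & <- & hl); [exact (IHp1 _ _ h1 h1' l' hl x) | exact (IHp2 _ _ h2 h2' l' hl x)].
  - destruct h as [h k], h' as [h' k'].
    destruct hl as [<- | hl].
    + apply (wit_unique (A := fun b => ~ tv p (G [false] (pair b x)))); [apply k|].
      intro b. replace (~ tv p (G [false] (pair b x))) with (~ tv p (G' [false] (pair b x)));
        [apply k'|].
      f_equal; apply propositional_extensionality.
      now rewrite (cond_correct h), (cond_correct h').
    + apply in_map_iff in hl; destruct hl as (l' & <- & hl). exact (IHp _ _ h h' l' hl x).
  - destruct h as [h k], h' as [h' k'].
    destruct hl as [<- | hl].
    + apply (wit_unique (A := fun b => tv p (G [false] (pair b x)))); [apply k|].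
      intro b. replace (tv p (G [false] (pair b x))) with (tv p (G' [false] (pair b x)));
        [apply k'|].
      apply propositional_extensionality.
      now rewrite (cond_correct h), (cond_correct h').
    + apply in_map_iff in hl; destruct hl as (l' & <- & hl). exact (IHp _ _ h h' l' hl x).
Qed.

Definition top_value (X : N -> Prop) (p : arith) (x : N) : N :=
  match p with
  | fex p => sk (fun a => sat (env_of (pair a x)) (scons X E) p)
  | fall p => sk (fun a => ~ sat (env_of (pair a x)) (scons X E) p)
  | p => bv (sat (env_of x) (scons X E) p)
  end.

(** The solution of [cond] computed from satisfaction itself, with default 0 at addresses where p
    has no subformula. *)
Fixpoint can (X : N -> Prop) (p : arith) (l : list bool) (x : N) : N :=
  match l with
  | [] => top_value X p x
  | b :: l => match p with
    | fnot p | fall p | fex p => if b then 0 else can X p l x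
    | fand p q | f_or p q | fimp p q => if b then can X q l x else can X p l x
    | _ => 0
    end
  end.

Lemma DF1_sat_env X p : sets X -> DR1 (fun x => sat (env_of x) (scons X E) p).
Proof.
  intro hX. apply (Def_sat hE p (v := fun _ e => env_of (e O)) (Y := fun _ _ => X)).
  - exact DF1_component.
  - defn.
Qed.

Lemma DF1_top X p : sets X -> DF1 (top_value X p).
Proof.
  intro hX; destruct p; simpl; unfold bv, sk; unfold DF1; cbn beta;
    try (apply TDef_ite; [exact (DF1_sat_env _ hX) | defn | defn]).
  - pose proof (DF1_sat_env p hX) as hp. pose (R := fun x => sat (env_of x) (scons X E) p).
    change (TDef (fun (_ : N -> Prop) e => ite (exists b, ~ R (pair b (e 0%nat)))
      (mu (fun a => ~ R (pair a (e 0%nat))) + 1) 0)). change (DR1 R) in hp. clearbody R. defn.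
  - pose proof (DF1_sat_env p hX) as hp. pose (R := fun x => sat (env_of x) (scons X E) p).
    change (TDef (fun (_ : N -> Prop) e => ite (exists b, R (pair b (e 0%nat)))
      (mu (fun a => R (pair a (e 0%nat))) + 1) 0)). change (DR1 R) in hp. clearbody R. defn.
Qed.

Lemma DF1_can X p : sets X -> forall l, DF1 (can X p l).
Proof.
  intro hX; induction p; intros [|[] l];
    try match goal with |- DF1 (can _ ?p []) => exact (DF1_top p hX) end;
    simpl; first [exact (IHp l) | exact (IHp1 l) | exact (IHp2 l) | exact (DF1_cst 0)].
Qed.

Lemma top_correct X p x : sets X -> tv p (top_value X p x) <-> sat (env_of x) (scons X E) p.
Proof.
  intro hX; destruct p; simpl; try exact (bv_neq0 _).
  - assert (sets (fun a => ~ sat (env_of (pair a x)) (scons X E) p)) as hs.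
    { apply comprehension, Def_not.
      exact (Def_R1 (DF1_sat_env p hX) (TDef_F2 DF2_pair (TDef_var 0) (TDef_const x))). }
    pose proof (wit_ex (sk_wit hs)) as w. split.
    + intros e a; rewrite scons_env_of. apply NNPP; intro n. apply (proj2 w); eauto.
    + intro l; apply NNPP; intro n; apply w in n; destruct n as [b hb]; apply hb.
      rewrite <- scons_env_of; apply l.
  - assert (sets (fun a => sat (env_of (pair a x)) (scons X E) p)) as hs.
    { apply comprehension.
      exact (Def_R1 (DF1_sat_env p hX) (TDef_F2 DF2_pair (TDef_var 0) (TDef_const x))). }
    rewrite (wit_ex (sk_wit hs)).
    split; intros [b hb]; exists b; [rewrite scons_env_of | rewrite <- scons_env_of]; exact hb.
Qed.

Lemma can_nil X p x : can X p [] x = top_value X p x.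
Proof. destruct p; reflexivity. Qed.

Lemma cond_can X p : sets X -> cond X p (can X p).
Proof.
  intro hX; induction p; simpl; try reflexivity.
  - split; [exact IHp|]. intro x; apply bv_iff. now rewrite can_nil, top_correct.
  - split; [auto|]. intro x; apply bv_iff.
    now rewrite !can_nil, !top_correct.
  - split; [auto|]. intro x; apply bv_iff.
    now rewrite !can_nil, !top_correct.
  - split; [auto|]. intro x; apply bv_iff.
    now rewrite !can_nil, !top_correct.
  - split; [exact IHp|]. intros x b.
    replace (tv p (can X p [] (pair b x))) with (sat (env_of (pair b x)) (scons X E) p).
    + apply (@sk_wit (fun a => ~ sat (env_of (pair a x)) (scons X E) p)).
      apply comprehension, Def_not.
      exact (Def_R1 (DF1_sat_env p hX) (TDef_F2 DF2_pair (TDef_var 0) (TDef_const x))).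
    + apply propositional_extensionality. now rewrite can_nil, top_correct.
  - split; [exact IHp|]. intros x b.
    replace (tv p (can X p [] (pair b x))) with (sat (env_of (pair b x)) (scons X E) p).
    + apply (@sk_wit (fun a => sat (env_of (pair a x)) (scons X E) p)).
      apply comprehension.
      exact (Def_R1 (DF1_sat_env p hX) (TDef_F2 DF2_pair (TDef_var 0) (TDef_const x))).
    + apply propositional_extensionality. now rewrite can_nil, top_correct.
Qed.

Lemma can_unused X p : forall l x, ~ In l (used p) -> can X p l x = 0.
Proof.
  induction p; intros [|[] l] x hl; simpl in *; try tauto;
    try (destruct hl; now left);
    (first [apply IHp | apply IHp1 | apply IHp2]); intro k; apply hl; right;
    first [apply in_map, k | apply in_or_app; (left; now apply in_map) || (right; now apply in_map)].
Qed.

End Skolem.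

(** * Enumerating the unique solutions of arithmetical conditions *)

Section Enumeration.
Context {M : L2_structure} {hM : model M}.
Local Open Scope L2_scope.
Notation N := (num M).
Context (E : nat -> N -> Prop) (hE : forall k, sets (E k)).

Fixpoint numeral (n : nat) : N := match n with O => 0 | S n => numeral n + 1 end.

Lemma numeral_inj m : forall n, numeral m = numeral n -> m = n.
Proof.
  induction m as [|m IH]; intros [|n] h; simpl in h; auto.
  - destruct (neq_succ0 (eq_sym h)).
  - destruct (neq_succ0 h).
  - f_equal; apply IH, (add_cancel_r h).
Qed.

Fixpoint enc (l : list bool) : nat :=
  match l with [] => O | b :: l => (if b then 2 + 2 * enc l else 1 + 2 * enc l)%nat end.

Lemma enc_inj l : forall l', enc l = enc l' -> l = l'.
Proof.
  induction l as [|b l IH]; intros [|b' l'] h; simpl in h; auto.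
  - destruct b'; lia.
  - destruct b; lia.
  - destruct b, b'; try lia; f_equal; apply IH; lia.
Qed.

(* A function h codes a number h(0), a set (by its characteristic function at the
   positions [posX]) and Skolem functions (at the positions [posG l]). *)
Definition posX (z : N) : N := pair (numeral 1) z.
Definition posG (l : list bool) (x : N) : N := pair (numeral (2 + enc l)) x.

Lemma zero_pair : (0 : N) = pair (numeral 0) 0.
Proof. unfold pair; simpl; now rewrite !add0, mul0, add0. Qed.

Lemma posG_inj l l' x y : posG l x = posG l' y -> l = l' /\ x = y.
Proof.
  intro h; apply pair_inj in h; destruct h as [h ->]; split; [|reflexivity].
  apply numeral_inj in h. apply enc_inj; lia.
Qed.
Lemma posX_neq0 x : posX x <> 0.
Proof. rewrite zero_pair; intro h; apply pair_inj, proj1, numeral_inj in h; discriminate. Qed.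
Lemma posG_neq0 l x : posG l x <> 0.
Proof. rewrite zero_pair; intro h; apply pair_inj, proj1, numeral_inj in h; discriminate. Qed.
Lemma posG_neqX l x y : posG l x <> posX y.
Proof. intro h; apply pair_inj, proj1, numeral_inj in h; simpl in h; lia. Qed.

Lemma DF1_posX : DF1 posX. Proof. unfold posX; defn. Qed.
Lemma DF1_posG l : DF1 (posG l). Proof. unfold posG; defn. Qed.
Hint Resolve DF1_posX DF1_posG : defs.

Lemma DR1_tv p : DR1 (@tv M p).
Proof. unfold DR1, tv; destruct p; defn. Qed.
Hint Resolve DR1_tv : defs.

Lemma closed_local_x (Q : N -> N -> N -> N -> Prop) l1 l2 l3 : DR4 Q ->
  closed (fun h => forall x, Q x (h (posG l1 x)) (h (posG l2 x)) (h (posG l3 x))).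
Proof. intro hQ; apply closed_local; defn. Qed.

Lemma closed_wit (B : N -> Prop) l1 l2 : DR1 B ->
  closed (fun h => forall x b, wit b (h (posG l1 x)) (B (h (posG l2 (pair b x))))).
Proof.
  intro hB.
  apply (@closed_iff M (fun h => forall k, wit (snd k) (h (posG l1 (fst k)))
    (B (h (posG l2 (pair (snd k) (fst k))))))).
  - intro h; split.
    + intros H x b; specialize (H (pair x b)); now rewrite fst_pair, snd_pair in H.
    + intros H k; apply H.
  - apply (closed_local (Q := fun k u v _ => wit (snd k) u (B v))
      (t1 := fun k => posG l1 (fst k)) (t2 := fun k => posG l2 (pair (snd k) (fst k)))
      (t3 := fun k => 0)); unfold wit; defn.
Qed.

(** The address prefix w is kept general because the clause for an immediate subformula moves to a
    longer address. *)
Lemma closed_cond p : forall w,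
  closed (fun h => cond E (fun z => h (posX z) <> 0) p (fun l x => h (posG (w ++ l) x))).
Proof.
  assert (forall q w b, closed (fun h => cond E (fun z => h (posX z) <> 0) q
      (fun l x => h (posG ((w ++ [b]) ++ l) x))) ->
    closed (fun h => cond E (fun z => h (posX z) <> 0) q
      (fun l x => h (posG (w ++ b :: l) x)))) as K.
  { intros q w b; apply closed_iff; intro h.
    replace (fun l x => h (posG ((w ++ [b]) ++ l) x)) with (fun l x => h (posG (w ++ b :: l) x));
      [reflexivity|].
    apply functional_extensionality; intro l; now rewrite <- app_assoc. }
  induction p; intro w; simpl.
  - pose proof (DF1_eval (M := M) s) as hs. pose proof (DF1_eval (M := M) t) as ht.
    apply (closed_local_x (Q := fun x u _ _ => u = bv (eval (env_of x) s = eval (env_of x) t)) _ [] []).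
    unfold bv; defn; [exact hs | exact ht].
  - pose proof (DF1_eval (M := M) s) as hs. pose proof (DF1_eval (M := M) t) as ht.
    apply (closed_local_x (Q := fun x u _ _ => u = bv (eval (env_of x) s < eval (env_of x) t)) _ [] []).
    unfold bv; defn; [exact hs | exact ht].
  - pose proof (DF1_eval (M := M) t) as ht. destruct k as [|k]; simpl.
    + apply (closed_local (Q := fun x u v _ => u = bv (v <> 0)) (t1 := posG (w ++ []))
        (t2 := fun x => posX (eval (env_of x) t)) (t3 := fun x => 0)); unfold bv; defn.
      exact ht.
    + pose proof (hE k) as hk.
      apply (closed_local_x (Q := fun x u _ _ => u = bv (E k (eval (env_of x) t))) _ [] []).
      unfold bv; defn. exact ht.
  - apply closed_and; [apply K, IHp|].
    apply (closed_local_x (Q := fun x u v _ => u = bv (~ tv p v)) _ _ []).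
    unfold bv; defn.
  - apply closed_and; [apply closed_and; apply K; auto|].
    apply (closed_local_x (Q := fun x u v w => u = bv (tv p1 v /\ tv p2 w))).
    unfold bv; defn.
  - apply closed_and; [apply closed_and; apply K; auto|].
    apply (closed_local_x (Q := fun x u v w => u = bv (tv p1 v \/ tv p2 w))).
    unfold bv; defn.
  - apply closed_and; [apply closed_and; apply K; auto|].
    apply (closed_local_x (Q := fun x u v w => u = bv (tv p1 v -> tv p2 w))).
    unfold bv; defn.
  - apply closed_and; [apply K, IHp|].
    apply (closed_wit (B := fun v => ~ tv p v)); defn.
  - apply closed_and; [apply K, IHp|].
    apply closed_wit; defn.
Qed.

Definition outside (ls : list (list bool)) (z : N) : Prop :=
  forall l, In l ls -> forall x, z <> posG l x.

Lemma DR1_outside ls : DR1 (outside ls).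
Proof.
  induction ls as [|l ls IH].
  - apply (Def_iff (A := fun _ _ => True)); [unfold outside; simpl; tauto | apply Def_const].
  - apply (Def_iff (A := fun _ e => (forall x, e O <> posG l x) /\ outside ls (e O))); [|defn].
    intros X e _; unfold outside; simpl; split.
    + intros [h k] l' [<- | hl]; auto.
    + intro h; split; auto.
Qed.
Hint Resolve DR1_outside : defs.

Fixpoint select (X : N -> Prop) (p : arith) (ls : list (list bool)) (z : N) : N :=
  match ls with
  | [] => 0
  | l :: ls => ite (exists x, z = posG l x) (can E X p l (snd z)) (select X p ls z)
  end.

Lemma DF1_select X p ls : sets X -> DF1 (select X p ls).
Proof.
  intro hX; induction ls as [|l ls IH]; simpl; [defn|].
  pose proof (DF1_can hE p hX l). defn.
Qed.

Lemma select_in X p ls l x : In l ls -> select X p ls (posG l x) = can E X p l x.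
Proof.
  induction ls as [|l' ls IH]; simpl; [tauto|].
  intros hl; destruct (classic (exists y, posG l x = posG l' y)) as [[y e] | n].
  - rewrite ite_true by eauto. apply posG_inj in e; destruct e as [-> ->].
    unfold posG; now rewrite snd_pair.
  - rewrite ite_false by exact n. apply IH; destruct hl as [-> | hl]; [|exact hl].
    destruct n; eauto.
Qed.

Lemma select_out X p ls z : outside ls z -> select X p ls z = 0.
Proof.
  induction ls as [|l ls IH]; simpl; [reflexivity|]. intro h.
  rewrite ite_false; [apply IH; intros l' hl; apply h; now right|].
  intros [x e]; apply (h l) with x; [now left | exact e].
Qed.

(** The quantifier over k with h 0 = k avoids using h 0 as a position, which keeps the clause local.
    The restriction to values 0 and 1 and the zeros at all remaining positions make h unique once
    the number h 0 and the set are fixed. *)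
Definition describes (p : arith) (h : N -> N) : Prop :=
  (cond E (fun z => h (posX z) <> 0) p (fun l x => h (posG l x)) /\
   (forall z, h (posX z) = 0 \/ h (posX z) = 1)) /\
  ((forall k, h 0 = k -> tv p (h (posG [] (pair k 0)))) /\
   forall z, z <> 0 -> (forall x, z <> posX x) -> outside (used p) z -> h z = 0).

Lemma closed_describes p : closed (describes p).
Proof.
  apply closed_and; apply closed_and.
  - exact (closed_cond p []).
  - apply (closed_local (Q := fun _ u _ _ => u = 0 \/ u = 1) (t1 := posX)
      (t2 := fun _ => 0) (t3 := fun _ => 0)); defn.
  - apply (closed_local (Q := fun k u v _ => u = k -> tv p v) (t1 := fun _ => 0)
      (t2 := fun k => posG [] (pair k 0)) (t3 := fun _ => 0)); defn.
  - apply (closed_local (Q := fun z u _ _ => z <> 0 -> (forall x, z <> posX x) ->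
      outside (used p) z -> u = 0) (t1 := fun z => z)
      (t2 := fun _ => 0) (t3 := fun _ => 0)); defn.
Qed.

Lemma describes_sat p h : DF1 h -> describes p h ->
  sat (env_of (pair (h 0) 0)) (scons (fun z => h (posX z) <> 0) E) p.
Proof. intros hh [[h1 _] [h2 _]]; apply (cond_correct h1), h2; reflexivity. Qed.

Lemma describes_exists p X j : sets X ->
  sat (env_of (pair j 0)) (scons X E) p ->
  exists h, DF1 h /\ describes p h /\ X = (fun z => h (posX z) <> 0).
Proof.
  intros hX hs.
  pose (h := fun z => ite (z = 0) j (ite (exists x, z = posX x) (bv (X (snd z)))
    (select X p (used p) z))).
  assert (DF1 h) as hh.
  { pose proof (@DF1_select X p (used p) hX). unfold h, bv; defn. }
  assert (forall z, h (posX z) = bv (X z)) as h1.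
  { intro z; unfold h. rewrite ite_false by apply posX_neq0. rewrite ite_true by eauto.
    unfold posX; now rewrite snd_pair. }
  assert (X = (fun z => h (posX z) <> 0)) as eX.
  { apply set_ext; intro z; rewrite h1. symmetry; apply bv_neq0. }
  assert ((fun l x => h (posG l x)) = can E X p) as eG.
  { apply functional_extensionality; intro l; apply functional_extensionality; intro x.
    unfold h. rewrite ite_false by apply posG_neq0.
    rewrite ite_false by (intros [y e]; exact (posG_neqX e)).
    destruct (classic (In l (used p))) as [k|k].
    - now apply select_in.
    - rewrite can_unused by exact k. apply select_out. intros l' hl y e.
      apply posG_inj in e; destruct e as [-> _]; tauto. }
  exists h; split; [exact hh|split; [|exact eX]].
  split; split.
  - rewrite <- eX, eG. now apply cond_can.
  - intro z; rewrite h1; unfold bv, ite; destruct excluded_middle_informative; auto.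
  - assert (h 0 = j) as -> by (unfold h; now rewrite ite_true).
    intros k <-. pose proof (f_equal (fun G => G [] (pair j 0)) eG) as e. cbn beta in e.
    rewrite e, can_nil. apply top_correct; auto.
  - intros z n1 n2 n3; unfold h. rewrite ite_false by exact n1.
    rewrite ite_false by (intros [x e]; exact (n2 x e)). now apply select_out.
Qed.

Hypothesis scattered_linear : forall P L : N -> Prop, sets P -> sets L ->
  linear_order P L -> scattered P L -> countably_many_initial_intervals P L.

(** In the tree of [describes p] a path is determined by its first entry j: the hypothesis fixes X,
    then [cond_unique] fixes the Skolem functions, and the rest is 0. Hence [KB_scattered] and
    [paths_enumerable] apply, and each listed path yields its set X. *)
Lemma unique_solutions_enumerable p :
  (forall j X Y, sets X -> sets Y -> sat (env_of (pair j 0)) (scons X E) p ->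
     sat (env_of (pair j 0)) (scons Y E) p -> X = Y) ->
  exists Z : N -> N -> Prop, DR2 Z /\ forall j X, sets X ->
    sat (env_of (pair j 0)) (scons X E) p -> exists n, X = Z n.
Proof.
  intro uniq.
  destruct (closed_tree (closed_describes p)) as (T & hT & tT & k).
  assert (scattered T (KB T)) as sc.
  { apply KB_scattered; auto. intros f g Pf Pg e.
    assert (DF1 f) as hf by apply Pf. assert (DF1 g) as hg by apply Pg.
    apply k in Pf; auto. apply k in Pg; auto.
    assert ((fun z => f (posX z) <> 0) = (fun z => g (posX z) <> 0)) as eX.
    { apply (uniq (f 0)); [defn | defn | now apply describes_sat |].
      rewrite e; now apply describes_sat. }
    destruct Pf as [[f1 f2] [f3 f4]], Pg as [[g1 g2] [g3 g4]].
    rewrite <- eX in g1.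
    intro z. destruct (classic (z = 0)) as [-> | n0]; [exact e|].
    destruct (classic (exists x, z = posX x)) as [[x ->] | n1].
    { assert (f (posX x) <> 0 <-> g (posX x) <> 0) as ex.
      { change ((fun z => f (posX z) <> 0) x <-> g (posX x) <> 0); rewrite eX; reflexivity. }
      pose proof (one_neq0 (M := M)) as n.
      destruct (f2 x) as [a | a], (g2 x) as [b | b]; rewrite a, b in *; tauto. }
    destruct (classic (outside (used p) z)) as [n2 | n2].
    - rewrite f4, g4; auto; intros x ex; apply n1; eauto.
    - apply not_all_ex_not in n2; destruct n2 as [l n2].
      apply imply_to_and in n2; destruct n2 as [hl n2].
      apply not_all_ex_not in n2; destruct n2 as [x n2]. apply NNPP in n2; subst z.
      exact (cond_unique f1 g1 hl x). }
  destruct (@paths_enumerable M hM T hT) as (Z & hZ & cov).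
  { apply scattered_linear; auto using sets_KB, KB_linear. }
  exists (fun n z => exists y, y <> 0 /\ Z n (posX z) y); split; [defn|].
  intros j X hX hs. destruct (describes_exists hX hs) as (h & hh & dh & ->).
  apply k in dh; auto. destruct (cov h dh) as [n hn]. exists n.
  apply set_ext; intro z; split.
  - intro e; exists (h (posX z)); split; [exact e | now apply hn].
  - intros (y & hy & hz); apply hn in hz; congruence.
Qed.

End Enumeration.

(** * Hierarchies along initial segments of a well-order *)

Section Hierarchies.
Context {M : L2_structure} {hM : model M}.
Local Open Scope L2_scope.
Notation N := (num M).
Notation env := (nat -> num M).
Context (p : arith) (e : env) (E : nat -> N -> Prop) (hE : forall k, sets (E k)).
Context (W L : N -> Prop) (hW : sets W) (hL : sets L) (hwo : well_order W L).

(** [is_hierarchy] for an arbitrary field D of levels, used for W and for the predecessors of a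
    point of W. *)
Definition hier (D Y : N -> Prop) : Prop := forall z, Y z <->
  exists n i, z = pair n i /\ D i /\ sat (scons n e) (scons (below L Y i) E) p.

Lemma hier_entry D Y n i : hier D Y ->
  (Y (pair n i) <-> D i /\ sat (scons n e) (scons (below L Y i) E) p).
Proof.
  intro h; rewrite (h (pair n i)); split.
  - intros (n' & i' & k & l); apply pair_inj in k; destruct k as [-> ->]; exact l.
  - intro l; exists n, i; auto.
Qed.

Lemma hier_pair D Y z : hier D Y -> Y z -> exists n i, z = pair n i /\ D i.
Proof. intros h k; apply h in k; destruct k as (n & i & k); exists n, i; tauto. Qed.

Lemma below_pair Y j n i : below L Y j (pair n i) <-> strict L i j /\ Y (pair n i).
Proof.
  split.
  - intros (n' & i' & k & l); apply pair_inj in k; destruct k as [-> ->]; exact l.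
  - intro l; exists n, i; auto.
Qed.

Lemma below_ext Y Y' j : (forall n i, strict L i j -> (Y (pair n i) <-> Y' (pair n i))) ->
  below L Y j = below L Y' j.
Proof.
  intro h; apply set_ext; intro z; split; intros (n & i & -> & k & l); exists n, i;
    repeat split; auto; try apply k; now apply h.
Qed.

Lemma hier_agree D D' Y Y' j : sets Y -> sets Y' -> hier D Y -> hier D' Y' ->
  (forall i, strict L i j -> (D i <-> D' i)) ->
  forall n i, strict L i j -> (Y (pair n i) <-> Y' (pair n i)).
Proof.
  intros hY hY' h h' hD n i hi. revert n.
  assert (W i) as wi by apply (coded_dom (proj1 (proj1 hwo)) (proj1 hi)).
  revert i wi hi.
  apply (@well_order_induction M hM W L (fun i => strict L i j ->
    forall n, Y (pair n i) <-> Y' (pair n i))); auto; [defn|].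
  intros i wi IH hi n. rewrite (hier_entry _ _ h), (hier_entry _ _ h'), (hD i hi).
  rewrite (@below_ext Y Y' i); [reflexivity|].
  intros m k hk; apply IH; [exact hk|].
  exact (strict_trans (proj1 (proj1 hwo)) hk hi).
Qed.

Lemma hier_unique j Y Y' : sets Y -> sets Y' -> hier (fun i => strict L i j) Y ->
  hier (fun i => strict L i j) Y' -> Y = Y'.
Proof.
  intros hY hY' h h'; apply set_ext; intro z.
  pose proof (@hier_agree _ _ Y Y' j hY hY' h h' (fun i _ => iff_refl _)) as A.
  split; intro k.
  - destruct (hier_pair h k) as (n & i & -> & hi); now apply A.
  - destruct (hier_pair h' k) as (n & i & -> & hi); now apply A.
Qed.

Lemma hier_below D Y i : hier D Y -> (forall k, strict L k i -> D k) ->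
  hier (fun k => strict L k i) (below L Y i).
Proof.
  intros h hD.
  assert (forall k, strict L k i -> below L (below L Y i) k = below L Y k) as B.
  { intros k hk; apply below_ext; intros m l hl; rewrite below_pair.
    split; [tauto|]. intro; split; auto. exact (strict_trans (proj1 (proj1 hwo)) hl hk). }
  intro z; split.
  - intros (n & k & -> & hk & l); exists n, k; rewrite (B k hk).
    apply (hier_entry _ _ h) in l; tauto.
  - intros (n & k & -> & hk & l); rewrite (B k hk) in l.
    apply below_pair; split; [exact hk|]. apply (hier_entry _ _ h); auto.
Qed.

Lemma Def_hier : Def (fun X v => hier (fun i => strict L i (v O)) X).
Proof.
  unfold hier. apply Def_all, Def_equiv; [defn|].
  apply Def_ex, Def_ex, Def_and; [defn|]. apply Def_and; [defn|].
  apply (Def_sat hE p (v := fun X v => scons (v 1%nat) e)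
    (Y := fun X v => below L X (v 0%nat))).
  - intros [|i]; simpl; defn.
  - unfold below; defn.
Qed.

Hypothesis scattered_linear : forall P L : N -> Prop, sets P -> sets L ->
  linear_order P L -> scattered P L -> countably_many_initial_intervals P L.

Lemma hierarchies_enumerable : exists Z : N -> N -> Prop, DR2 Z /\ forall j Y, sets Y ->
  hier (fun i => strict L i j) Y -> exists n, Y = Z n.
Proof.
  destruct Def_hier as (q & F & hF & hq).
  assert (forall j X, sets X -> (sat (env_of (pair j 0)) (scons X F) q <->
    hier (fun i => strict L i j) X)) as K.
  { intros j X hX; rewrite hq by exact hX. unfold env_of; simpl; now rewrite fst_pair. }
  destruct (@unique_solutions_enumerable M hM F hF scattered_linear q) as (Z & hZ & h).
  - intros j X Y hX hY h1 h2; apply K in h1, h2; auto. exact (hier_unique hX hY h1 h2).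
  - exists Z; split; [exact hZ|]. intros j Y hY hj; apply (h j); auto. now apply K.
Qed.

Lemma hierarchy_exists : exists Y, sets Y /\ is_hierarchy p e E W L Y.
Proof.
  destruct hierarchies_enumerable as (Z & hZ & cov).
  assert (forall n, sets (Z n)) as sZ by (intro n; defn).
  assert (DR2 (fun n i => hier (fun k => strict L k i) (Z n))) as dH.
  { unfold hier. apply Def_all, Def_equiv; [defn|].
    apply Def_ex, Def_ex, Def_and; [defn|]. apply Def_and; [defn|].
    apply (Def_sat hE p (v := fun X v => scons (v 1%nat) e)
      (Y := fun X v => below L (Z (v 3%nat)) (v 0%nat))).
    - intros [|i]; simpl; defn.
    - unfold below; defn. }
  set (HZ := fun n i => hier (fun k => strict L k i) (Z n)) in *.
  (* Level i of the glued set is computed from any listed hierarchy along the predecessors of i; by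
     [hier_unique] all of them give the same result. *)
  pose (glue := fun D z => exists m i, z = pair m i /\ D i /\
    exists n, HZ n i /\ sat (scons m e) (scons (Z n) E) p).
  assert (forall D, sets D -> sets (glue D)) as sG.
  { intros D hD; unfold glue; apply comprehension.
    apply Def_ex, Def_ex, Def_and; [defn|]. apply Def_and; [defn|].
    apply Def_ex, Def_and; [defn|].
    apply (Def_sat hE p (v := fun X v => scons (v 2%nat) e) (Y := fun X v => Z (v 0%nat))).
    - intros [|i]; simpl; defn.
    - defn. }
  assert (forall D : N -> Prop, sets D -> (forall i, D i -> exists n, HZ n i) ->
    (forall i k, strict L k i -> D i -> D k) -> hier D (glue D)) as gH.
  { intros D sD hD dD.
    (* For k below i, the part of [Z n] below k is the unique hierarchy along the predecessors of k,
       so level k of [Z n] and level k of the glued set are computed from the same set. *)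
    assert (forall i n, D i -> HZ n i -> below L (glue D) i = Z n) as B.
    { intros i n hi hn; apply set_ext; intro z.
      assert (forall m k, strict L k i -> (Z n (pair m k) <-> glue D (pair m k))) as C.
      { intros m k hk. rewrite (hier_entry m k hn). split.
        - intros [_ l]. destruct (hD k (dD i k hk hi)) as [n' hn'].
          exists m, k; split; [reflexivity|]; split; [exact (dD i k hk hi)|].
          exists n'; split; [exact hn'|].
          rewrite (@hier_unique k (Z n') (below L (Z n) k)); auto.
          + unfold below; defn.
          + apply (hier_below hn). intros u hu; exact (strict_trans (proj1 (proj1 hwo)) hu hk).
        - intros (m' & k' & ee & _ & n' & hn' & l); apply pair_inj in ee; destruct ee as [<- <-].
          split; [exact hk|].
          rewrite (@hier_unique k (Z n') (below L (Z n) k)) in l; auto.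
          + unfold below; defn.
          + apply (hier_below hn). intros u hu; exact (strict_trans (proj1 (proj1 hwo)) hu hk). }
      split.
      - intros (m & k & -> & hk & l); now apply C.
      - intro l; destruct (hier_pair hn l) as (m & k & -> & hk).
        apply below_pair; split; [exact hk|]; now apply C. }
    intro z; split.
    - intros (m & i & -> & hi & n & hn & l); exists m, i; rewrite (B i n hi hn); auto.
    - intros (m & i & -> & hi & l). destruct (hD i hi) as [n hn].
      exists m, i; split; [reflexivity|]; split; [exact hi|]; exists n; split; [exact hn|].
      now rewrite <- (B i n hi hn). }
  (* That i has a listed hierarchy is arithmetical, so induction along W applies: gluing over the
     predecessors of j gives a hierarchy for j, and the enumeration must list it. *)
  assert (forall i, W i -> exists n, HZ n i) as all.
  { apply (well_order_induction (phi := fun i => exists n, HZ n i) hW hL hwo); [defn|].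
    intros j wj IH.
    assert (sets (fun i => strict L i j)) as sj by defn.
    assert (hier (fun i => strict L i j) (glue (fun i => strict L i j))) as hj.
    { apply gH; auto. intros i k; apply (strict_trans (proj1 (proj1 hwo))). }
    destruct (cov j _ (sG _ sj) hj) as [n hn]; exists n. unfold HZ; now rewrite <- hn. }
  exists (glue W); split; [now apply sG|].
  apply gH; auto. intros i k hk _; apply (coded_dom (proj1 (proj1 hwo)) (proj1 hk)).
Qed.

End Hierarchies.

(** * Pieces of a partial order *)

Section Pieces.
Context {M : L2_structure} {hM : model M}.
Local Open Scope L2_scope.
Notation N := (num M).
Context (P L : N -> Prop) (hP : sets P) (hL : sets L) (hpo : partial_order P L).

Lemma zero_neq1 : (0 : N) <> 1.
Proof. intro h; exact (one_neq0 (eq_sym h)). Qed.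
Lemma two_neq0 : (1 + 1 : N) <> 0.
Proof. apply neq_succ0. Qed.
Lemma two_neq1 : (1 + 1 : N) <> 1.
Proof. intro h; rewrite <- (add0 1) in h at 3; apply add_cancel_r in h; exact (one_neq0 h). Qed.

Definition perp (x y : N) : Prop := ~ coded L x y /\ ~ coded L y x.
Lemma DR2_perp : DR2 perp. Proof. unfold perp; defn. Qed.
Hint Resolve DR2_perp : defs.

(* The sequence coded by the first component of a piece lists constraints [(r, x)]:
   below x for r = 0, above x for r = 1, incomparable with x for r = 2; the second component only serves to make the
   code of a subpiece larger. *)
Definition constraint (k y : N) : Prop :=
  (fst k = 0 -> strict L y (snd k)) /\ (fst k = 1 -> strict L (snd k) y) /\
  (fst k = 1 + 1 -> perp y (snd k)).
Definition piece (c y : N) : Prop :=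
  P y /\ forall i, i < len (fst c) -> constraint (ent (fst c) i) y.
Definition child (r c x : N) : N := pair (app (fst c) (pair r x)) (c + 1).
Definition whole : N := pair emp 0.

Lemma DR2_piece : DR2 piece. Proof. unfold piece, constraint; defn. Qed.
Lemma DF3_child : DF3 child. Proof. unfold child; defn. Qed.
Hint Resolve DR2_piece DF3_child : defs.

Lemma child_gt r c x : c < child r c x.
Proof. apply lt_le_trans with (c + 1); [apply lt_succ_diag | apply le_pair_r]. Qed.

Lemma piece_whole y : piece whole y <-> P y.
Proof.
  unfold piece, whole; rewrite fst_pair, len_emp; split; [tauto|].
  intro h; split; [exact h|]; intros i hi; destruct (nlt0 hi).
Qed.

Lemma piece_child r c x y : piece (child r c x) y <-> piece c y /\ constraint (pair r x) y.
Proof.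
  unfold piece, child; rewrite fst_pair, len_app; split.
  - intros [hy h]; split; [split; [exact hy|]|].
    + intros i hi; specialize (h i); rewrite ent_app in h by exact hi; apply h; ord.
    + specialize (h (len (fst c))); rewrite ent_app_last in h; apply h, lt_succ_diag.
  - intros [[hy h] k]; split; [exact hy|]. intros i hi.
    apply lt_succ in hi; destruct hi as [hi | ->].
    + rewrite ent_app by exact hi; auto.
    + rewrite ent_app_last; exact k.
Qed.

Lemma piece_lt c x y : piece (child 0 c x) y <-> piece c y /\ strict L y x.
Proof.
  rewrite piece_child; unfold constraint; rewrite fst_pair, snd_pair.
  pose proof zero_neq1; pose proof two_neq0 as h; apply not_eq_sym in h. tauto.
Qed.
Lemma piece_gt c x y : piece (child 1 c x) y <-> piece c y /\ strict L x y.
Proof.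
  rewrite piece_child; unfold constraint; rewrite fst_pair, snd_pair.
  pose proof one_neq0 (M := M); pose proof two_neq1 as h; apply not_eq_sym in h. tauto.
Qed.
Lemma piece_perp c x y : piece (child (1 + 1) c x) y <-> piece c y /\ perp y x.
Proof.
  rewrite piece_child; unfold constraint; rewrite fst_pair, snd_pair.
  pose proof two_neq0; pose proof two_neq1. tauto.
Qed.

(* A nonzero label v of the piece c names a point x of c and a promise: either the
   points of c incomparable with x form a large piece, or both the points below
   and the points above x do. *)
Definition valid (v c : N) : Prop :=
  exists x, piece c x /\ (v = pair x 0 + 1 \/ v = pair x 1 + 1).
Definition req (v c c' : N) : Prop :=
  exists x, (v = pair x 0 + 1 /\ c' = child (1 + 1) c x) \/
    (v = pair x 1 + 1 /\ (c' = child 0 c x \/ c' = child 1 c x)).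
Lemma DR2_valid : DR2 valid. Proof. unfold valid; defn. Qed.
Lemma DR3_req : DR3 req. Proof. unfold req; defn. Qed.
Hint Resolve DR2_valid DR3_req : defs.

(** A family B is self-supporting exactly when each of its members c satisfies [der B c]. *)
Definition der (B : N -> Prop) (c : N) : Prop :=
  exists v, valid v c /\ forall c', req v c c' -> B c'.

Lemma req_gt v c c' : req v c c' -> c < c'.
Proof. intros [x [[_ ->] | [_ [-> | ->]]]]; apply child_gt. Qed.

Lemma der_cases B c : der B c -> exists x, piece c x /\
  (B (child (1 + 1) c x) \/ (B (child 0 c x) /\ B (child 1 c x))).
Proof.
  intros (v & (x & hx & [-> | ->]) & h); exists x; split; auto;
    [left | right; split]; apply h; exists x; auto.
Qed.

Lemma der_perp (B : N -> Prop) c x : piece c x -> B (child (1 + 1) c x) -> der B c.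
Proof.
  intros hx h; exists (pair x 0 + 1); split; [exists x; auto|].
  intros c' [x' [[e ->] | [e _]]]; apply add_cancel_r, pair_inj in e; destruct e as [<- e].
  - exact h.
  - destruct (zero_neq1 e).
Qed.

Lemma der_split (B : N -> Prop) c x : piece c x -> B (child 0 c x) -> B (child 1 c x) -> der B c.
Proof.
  intros hx h h'; exists (pair x 1 + 1); split; [exists x; auto|].
  intros c' [x' [[e _] | [e [-> | ->]]]]; apply add_cancel_r, pair_inj in e; destruct e as [<- e];
    auto.
  destruct (one_neq0 e).
Qed.

(** Entry c of s is the label of the piece with code c, and 0 leaves the piece out of the family.
    Promised pieces have larger codes ([req_gt]), so a promise beyond the length of s is still
    pending and a new entry never disturbs earlier ones. *)
Definition attempt (s : N) : Prop :=
  Seq s /\ (whole < len s -> ent s whole <> 0) /\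
  forall c, c < len s -> ent s c <> 0 ->
    valid (ent s c) c /\ forall c', req (ent s c) c c' -> c' < len s -> ent s c' <> 0.

Lemma sets_attempt : sets attempt. Proof. unfold attempt; defn. Qed.

Lemma tree_attempt : tree attempt.
Proof.
  split; [intros s h; apply h|].
  intros s k (hs & h1 & h2) hk; split; [apply Seq_take|]; rewrite len_take; split.
  - intro h; rewrite ent_take by exact h; apply h1; ord.
  - intros c hc; rewrite ent_take by exact hc. intro n.
    destruct (h2 c) as [h3 h4]; auto; [ord|]. split; [exact h3|].
    intros c' r l; rewrite ent_take by exact l; apply h4; auto; ord.
Qed.

Lemma attempt_path f : is_path attempt f ->
  f whole <> 0 /\ forall c, f c <> 0 -> der (fun c' => f c' <> 0) c.
Proof.
  intros [hf h]; split.
  - destruct (h (whole + 1)) as (_ & k & _).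
    rewrite len_restr, ent_restr in k by auto using lt_succ_diag. auto using lt_succ_diag.
  - intros c hc; exists (f c); split.
    + destruct (h (c + 1)) as (_ & _ & k). destruct (k c) as [k' _].
      * rewrite len_restr by auto; apply lt_succ_diag.
      * rewrite ent_restr by auto using lt_succ_diag; exact hc.
      * rewrite ent_restr in k' by auto using lt_succ_diag; exact k'.
    + intros c' r. pose proof (req_gt r) as l.
      destruct (h (c' + 1)) as (_ & _ & k).
      rewrite len_restr in k by auto.
      assert (c < c' + 1) as l1 by ord. assert (c' < c' + 1) as l2 by ord.
      specialize (k c l1). rewrite ent_restr in k by auto.
      destruct (k hc) as [_ k']. specialize (k' c' r l2). now rewrite ent_restr in k' by auto.
Qed.

Definition promised (s c' : N) : Prop :=
  c' = whole \/ exists c, c < len s /\ req (ent s c) c c'.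
Lemma DR2_promised : DR2 promised. Proof. unfold promised; defn. Qed.
Hint Resolve DR2_promised : defs.

Lemma not_promised_0 c c' : ~ req 0 c c'.
Proof. intros [x [[e _] | [e _]]]; exact (neq_succ0 (eq_sym e)). Qed.

Lemma valid_neq0 v c : valid v c -> v <> 0.
Proof. intros (x & _ & [-> | ->]); apply neq_succ0. Qed.

Lemma attempt_extend s m : attempt s -> (promised s (len s) -> m <> 0) ->
  (m <> 0 -> valid m (len s)) -> attempt (app s m).
Proof.
  intros (hs & h1 & h2) hm hv; split; [apply Seq_app|]; rewrite len_app; split.
  - intro h; apply lt_succ in h; destruct h as [h | h].
    + rewrite ent_app by exact h; auto.
    + rewrite h, ent_app_last; apply hm; left; now symmetry.
  - intros c hc; apply lt_succ in hc; destruct hc as [hc | ->].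
    + rewrite ent_app by exact hc; intro n. destruct (h2 c hc n) as [h3 h4].
      split; [exact h3|]. intros c' r l; apply lt_succ in l; destruct l as [l | ->].
      * rewrite ent_app by exact l; auto.
      * rewrite ent_app_last; apply hm; right; eauto.
    + rewrite ent_app_last; intro n; split; [auto|].
      intros c' r l; apply req_gt in r; exfalso; ord.
Qed.

Context (hATR : arith_transfinite_recursion M).

(** Arithmetical transfinite recursion for operators that are definable in the sense of [Def]
    instead of given by a formula. *)
Lemma transfinite_recursion (theta : (N -> Prop) -> N -> Prop) (W R : N -> Prop) :
  sets W -> sets R -> well_order W R -> Def (fun X e => theta X (e O)) ->
  exists Y, sets Y /\ forall n j, W j -> (Y (pair n j) <-> theta (below R Y j) n).
Proof.
  intros hW hR hwo (p & E & hE & hp).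
  destruct (hATR p (fun _ => 0) hE hW hR hwo) as (Y & hY & h).
  exists Y; split; [exact hY|]. intros n j hj.
  change (hier p (fun _ => 0) E R W Y) in h. rewrite (hier_entry n j h).
  assert (sets (below R Y j)) as hb by (unfold below; defn).
  rewrite hp by exact hb. simpl; tauto.
Qed.

Context (no_path : ~ exists f, is_path attempt f).
Let W := attempt.
Let R := KB attempt.

Let hW : sets W := sets_attempt.
Let hR : sets R := sets_KB sets_attempt.
Let hwo : well_order W R := KB_well_order sets_attempt tree_attempt no_path.

(** * Ranks of pieces and the enumeration of intervals by rank *)

Section Ranked.
(** [S j c] reads: c has rank at most j. The equation says that every valid label of c promises some
    piece with a rank strictly below j. *)
Context (S : N -> N -> Prop) (hS : DR2 S)
  (S_iff : forall j c, W j -> (S j c <-> ~ der (fun c' => ~ exists i, strict R i j /\ S i c') c)).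

Lemma S_mono i j c : W i -> W j -> strict R i j -> S i c -> S j c.
Proof.
  intros wi wj hij h; rewrite S_iff in * by auto. intros (v & hv & k); apply h.
  exists v; split; [exact hv|]. intros c' r (k' & k1 & k2).
  apply (k c' r); exists k'; split; [|exact k2].
  exact (strict_trans (proj1 (proj1 hwo)) k1 hij).
Qed.

Lemma emp_attempt : attempt emp.
Proof.
  split; [apply Seq_emp|]; rewrite len_emp; split; [intro h; destruct (nlt0 h)|].
  intros c h; destruct (nlt0 h).
Qed.

Lemma app_below s m : attempt s -> attempt (app s m) -> strict R (app s m) s.
Proof.
  intros h k; apply KB_strict; auto using tree_attempt.
  - left; apply pre_app.
  - intro e; pose proof (len_app s m) as l; rewrite e in l. ord.
Qed.

(* Otherwise all promises can be kept with pieces that are still large at the rank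
   of the current attempt, which yields a path. *)
Lemma whole_small : S emp whole.
Proof.
  apply NNPP; intro big. apply no_path.
  destruct (@path_exists M hM (fun s => attempt s /\
    forall c, promised s c -> len s <= c -> ~ S s c)) as (f & hf & k).
  - pose proof sets_attempt; defn.
  - split; [apply emp_attempt|]. intros c [-> | (c0 & h & _)] _; [exact big|].
    rewrite len_emp in h; destruct (nlt0 h).
  - intros s hs [as_ inv].
    assert (exists m, attempt (app s m) /\ (forall c, req m (len s) c ->
      ~ exists i, strict R i s /\ S i c)) as (m & hm & hreq).
    { destruct (classic (promised s (len s))) as [pr | npr].
      - pose proof (inv _ pr (or_intror eq_refl)) as b. rewrite S_iff in b by exact as_.
        apply NNPP in b. destruct b as (v & hv & hr). exists v; split; [|exact hr].
        apply attempt_extend; auto. intros _; exact (valid_neq0 hv).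
      - exists 0; split; [apply attempt_extend; tauto|].
        intros c r; destruct (not_promised_0 r). }
    pose proof (app_below as_ hm) as hlt.
    exists m; split; [exact hm|]. intros c pr l bad.
    rewrite len_app in l.
    destruct pr as [-> | (c0 & h1 & h2)].
    + apply (inv whole); [left; reflexivity | ord |]. apply (S_mono (i := app s m)); auto.
    + rewrite len_app in h1; apply lt_succ in h1; destruct h1 as [h1 | ->].
      * rewrite ent_app in h2 by exact h1.
        apply (inv c); [right; eauto | ord |]. apply (S_mono (i := app s m)); auto.
      * rewrite ent_app_last in h2. apply (hreq c h2); eauto.
  - exists f; split; [exact hf|]. intro n; apply k.
Qed.

(** A recursive call for the piece c: its index a carries the rank [fst a] at which the call is made
    and the index [snd a] used there. *)
Definition call (X : N -> Prop) (c a m : N) : Prop :=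
  X (pair (pair (pair c (snd a)) m) (fst a)).

(* An index n of an initial interval I of the piece c, with first component
   0: I consists of the points x of c such that the piece below x has smaller rank;
   1: x is not in I, so I is determined on the points below and incomparable with x;
   2: x is in I, so I is determined on the points above and incomparable with x. *)
Definition enum_step (X : N -> Prop) (z : N) : Prop :=
  let c := fst (fst z) in let n := snd (fst z) in let m := snd z in
  let x := fst (snd n) in let a := fst (snd (snd n)) in let b := snd (snd (snd n)) in
  (fst n = 0 /\ piece c m /\ exists k, strict R k (snd n) /\ S k (child 0 c m)) \/
  (fst n = 1 /\ (call X (child 0 c x) a m \/ call X (child (1 + 1) c x) b m)) \/
  (fst n = 1 + 1 /\ ((piece c m /\ coded L m x) \/
     call X (child 1 c x) a m \/ call X (child (1 + 1) c x) b m)).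

Lemma Def_enum_step : Def (fun X e => enum_step X (e O)).
Proof. unfold enum_step, call; cbv zeta; defn. Qed.

Section Interval.
Context (Y : N -> Prop) (hY : sets Y)
  (Y_iff : forall z j, W j -> (Y (pair z j) <-> enum_step (below R Y j) z)).
Context (J : N -> Prop) (hJ : sets J) (iJ : initial_interval P L J).

Definition listed (j c n : N) : Prop :=
  forall m, (J m /\ piece c m) <-> Y (pair (pair (pair c n) m) j).

Lemma small_listed j c : W j ->
  (forall i, strict R i j -> forall c, S i c -> exists n, listed i c n) ->
  (exists i, strict R i j /\ S i c) ->
  exists a, forall m, (J m /\ piece c m) <-> call (below R Y j) c a m.
Proof.
  intros wj IH (i & hi & si). destruct (IH i hi c si) as [n hn].
  exists (pair i n); intro m. unfold call. rewrite fst_pair, snd_pair, below_pair, (hn m). tauto.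
Qed.

Lemma intervals_listed j : W j -> forall c, S j c -> exists n, listed j c n.
Proof.
  revert j.
  apply (well_order_induction (phi := fun j => forall c, S j c -> exists n, listed j c n)
    hW hR hwo); [unfold listed; defn|].
  intros j wj IH c hc. rewrite S_iff in hc by exact wj.
  pose (sm := fun c => exists i, strict R i j /\ S i c).
  (* As c is ranked, every label fails: for each point of c the incomparable part has smaller rank,
     and so has at least one of the two sides. *)
  assert (forall x, piece c x -> sm (child (1 + 1) c x)) as s1.
  { intros x hx; apply NNPP; intro n; apply hc, (der_perp hx); exact n. }
  assert (forall x, piece c x -> sm (child 0 c x) \/ sm (child 1 c x)) as s2.
  { intros x hx; apply NNPP; intro n; apply hc, (der_split hx); fold (sm (child 0 c x));
      fold (sm (child 1 c x)); tauto. }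
  unfold listed.
  destruct (classic (exists x, piece c x /\ sm (child 0 c x) /\ ~ J x)) as [(x & hx & h1 & h2) | n1].
  - destruct (small_listed wj IH h1) as [a ha].
    destruct (small_listed wj IH (s1 x hx)) as [b hb].
    exists (pair 1 (pair x (pair a b))); intro m.
    rewrite Y_iff by exact wj. unfold enum_step.
    repeat (rewrite fst_pair || rewrite snd_pair).
    rewrite <- (ha m), <- (hb m), piece_lt, piece_perp.
    pose proof (one_neq0 (M := M)). pose proof two_neq1 as n21; apply not_eq_sym in n21.
    split; [|tauto].
    intros [k1 k2]. right; left; split; [reflexivity|].
    unfold strict, perp. destruct (classic (coded L x m)) as [l | l].
    + destruct h2; exact (proj2 iJ x m l k1).
    + tauto.
  - destruct (classic (exists x, piece c x /\ ~ sm (child 0 c x) /\ J x))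
      as [(x & hx & h1 & h2) | n2].
    + assert (sm (child 1 c x)) as h1' by (destruct (s2 x hx); tauto).
      destruct (small_listed wj IH h1') as [a ha].
      destruct (small_listed wj IH (s1 x hx)) as [b hb].
      exists (pair (1 + 1) (pair x (pair a b))); intro m.
      rewrite Y_iff by exact wj. unfold enum_step.
      repeat (rewrite fst_pair || rewrite snd_pair).
      rewrite <- (ha m), <- (hb m), piece_gt, piece_perp.
      pose proof two_neq0. pose proof two_neq1.
      split.
      * intros [k1 k2]. right; right; split; [reflexivity|].
        unfold strict, perp. destruct (classic (coded L m x)); tauto.
      * intros [k | [k | [_ [[k l] | k]]]]; try tauto.
        split; [exact (proj2 iJ m x l h2) | exact k].
    (* No point of c is an exception, so a point of c lies in J exactly when its lower part has rank
       below j. The index stores j because the test compares ranks with it. *)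
    + exists (pair 0 j); intro m.
      rewrite Y_iff by exact wj. unfold enum_step.
      repeat (rewrite fst_pair || rewrite snd_pair).
      pose proof (zero_neq1). pose proof two_neq0 as n20; apply not_eq_sym in n20.
      fold (sm (child 0 c m)). split.
      * intros [k1 k2]; left; split; [reflexivity|]; split; [exact k2|].
        apply NNPP; intro l; apply n2; eauto.
      * intros [(_ & k1 & k2) | k]; [|tauto]. split; [|exact k1].
        apply NNPP; intro l; apply n1; eauto.
Qed.
End Interval.
End Ranked.

(** Two recursions run along the same well-order of attempts, one for the ranks and one for the
    enumeration. The result is read at [emp], the largest node, where [whole_small] ranks the whole
    order. *)
Lemma countably_many_of_no_path : countably_many_initial_intervals P L.
Proof.
  destruct (@transfinite_recursion
    (fun X c => ~ der (fun c' => ~ exists i, X (pair c' i)) c) W R) as (S0 & hS0 & k); auto.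
  { unfold der; defn. }
  pose (S := fun j c => S0 (pair c j)).
  assert (DR2 S) as hS by (unfold S; defn).
  assert (forall j c, W j -> (S j c <-> ~ der (fun c' => ~ exists i, strict R i j /\ S i c') c))
    as S_iff.
  { intros j c wj; unfold S; rewrite k by exact wj.
    replace (fun c' => ~ exists i, below R S0 j (pair c' i))
      with (fun c' => ~ exists i, strict R i j /\ S0 (pair c' i)); [reflexivity|].
    apply set_ext; intro c'. split; intros n [i h]; apply n; exists i; now apply below_pair. }
  destruct (@transfinite_recursion (enum_step S) W R) as (Y & hY & kY); auto.
  { apply Def_enum_step; exact hS. }
  exists (fun z => exists m n, z = pair m n /\ Y (pair (pair (pair whole n) m) emp)); split; [defn|].
  intros J hJ iJ.
  destruct (@intervals_listed S hS S_iff Y hY kY J hJ iJ emp emp_attempt whole) as [n hn].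
  { apply whole_small; auto. }
  exists n; intro m. split.
  - intro h; exists m, n; split; [reflexivity|]. apply hn; split; [exact h|].
    apply piece_whole, iJ, h.
  - intros (m' & n' & e & h); apply pair_inj in e; destruct e as [<- <-]. now apply hn in h.
Qed.

End Pieces.

(** * Large pieces yield infinite antichains or copies of the rationals *)

Section Large.
Context {M : L2_structure} {hM : model M}.
Local Open Scope L2_scope.
Notation N := (num M).
Context (P L : N -> Prop) (hP : sets P) (hL : sets L) (hpo : partial_order P L).
Context (B : N -> Prop) (hB : sets B) (B_whole : B whole) (B_der : forall c, B c -> der P L B c).

Let piece := piece P L.
Let dpiece : DR2 piece := DR2_piece hP hL.
Let dperp : DR2 (perp L) := DR2_perp hL.

Lemma piece_in c y : piece c y -> P y.
Proof. intro h; apply h. Qed.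

(** By induction on m the indices with values below m are bounded, since raising m by one admits at
    most one new index. *)
Lemma injective_unbounded (f : N -> N) : DF1 f -> (forall i k, k < i -> f i <> f k) ->
  forall m, exists i, m < f i.
Proof.
  intros hf inj m.
  assert (forall m, exists b, forall i, f i < m -> i < b) as K.
  { apply induction; [defn | |].
    - exists 0; intros i h; destruct (nlt0 h).
    - intros n [b hb]. destruct (classic (exists i, f i = n)) as [[i0 e] | no].
      + exists (b + i0 + 1); intros i h; apply lt_succ in h.
        assert (b <= b + i0) by (apply le_iff; eauto).
        assert (i0 <= b + i0) by (apply le_iff; exists b; apply addC).
        destruct h as [h | h].
        * apply hb in h; ord.
        * destruct (lt_total i i0) as [l | [-> | l]]; [ord | ord |].
          destruct (inj _ _ l); congruence.
      + exists b; intros i h; apply lt_succ in h; destruct h as [h | h]; [auto|].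
        destruct no; eauto. }
  destruct (K (m + 1)) as [b hb]. exists b. apply NNPP; intro n.
  apply (@lt_irrefl M hM b), hb. ord.
Qed.

(** Iterating the hypothesis gives points together with shrinking pieces of B, each piece
    incomparable with its point. Later points lie in all earlier pieces, so the points are pairwise
    incomparable, and distinct by reflexivity. *)
Lemma antichain_of_large :
  (forall c, B c -> exists x c', piece c x /\ B c' /\ (forall y, piece c' y -> piece c y) /\
     forall y, piece c' y -> perp L y x) ->
  exists A, sets A /\ antichain P L A /\ infinite A.
Proof.
  intro step.
  destruct (@path_exists M hM (fun s => forall i, i < len s ->
     P (fst (ent s i)) /\ B (snd (ent s i)) /\
     (forall y, piece (snd (ent s i)) y -> perp L y (fst (ent s i))) /\
     forall k, k < i -> piece (snd (ent s k)) (fst (ent s i)) /\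
       forall y, piece (snd (ent s i)) y -> piece (snd (ent s k)) y)) as (f & hf & K).
  - defn.
  - rewrite len_emp; intros i h; destruct (nlt0 h).
  - intros s hs h.
    assert (exists c, B c /\ forall k, k < len s -> forall y, piece c y -> piece (snd (ent s k)) y)
      as (c & bc & hc).
    { destruct (zero_or_succ (len s)) as [e | [n e]].
      - exists whole; split; [exact B_whole|]. rewrite e; intros k hk; destruct (nlt0 hk).
      - assert (n < len s) as l by (rewrite e; apply lt_succ_diag).
        exists (snd (ent s n)); split; [now apply h|].
        intros k hk y hy; rewrite e in hk; apply lt_succ in hk; destruct hk as [hk | ->];
          [now apply (h n l) | exact hy]. }
    destruct (step c bc) as (x & c' & h1 & h2 & h3 & h4).
    exists (pair x c'); intros i hi; rewrite len_app in hi; apply lt_succ in hi.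
    destruct hi as [hi | ->].
    + rewrite ent_app by exact hi. destruct (h i hi) as (k1 & k2 & k3 & k4).
      split; [exact k1|]. split; [exact k2|]. split; [exact k3|].
      intros k hk; rewrite ent_app by ord; now apply k4.
    + rewrite ent_app_last, fst_pair, snd_pair.
      split; [exact (piece_in h1)|]. split; [exact h2|]. split; [exact h4|].
      intros k hk; rewrite ent_app by exact hk. split; [now apply hc|].
      intros y hy; apply (hc k hk); auto.
  - assert (forall i k, k < i -> P (fst (f i)) /\ P (fst (f k)) /\ perp L (fst (f i)) (fst (f k)))
      as Q.
    { intros i k hk. pose proof (K (i + 1)) as H. rewrite len_restr in H by auto.
      assert (i < i + 1) as l1 by ord. assert (k < i + 1) as l2 by ord.
      destruct (H i l1) as (a1 & _ & _ & a2). destruct (H k l2) as (b1 & _ & b2 & _).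
      specialize (a2 k hk). rewrite !ent_restr in * by auto.
      split; [exact a1|]. split; [exact b1|]. now apply b2. }
    pose (x := fun i => fst (f i)).
    assert (DF1 x) as hx by (unfold x; defn).
    exists (fun y => exists i, y = x i); split; [defn|]. split; [split|].
    + intros y [i ->]. destruct (Q (i + 1) i (lt_succ_diag i)); tauto.
    + intros y z [i ->] [k ->] n.
      destruct (lt_total i k) as [l | [-> | l]]; [ | tauto | ];
        destruct (Q _ _ l) as (_ & _ & a & b); auto.
    + intro m. destruct (@injective_unbounded x hx) with (m := m) as [i hi].
      * intros i k hk e. destruct (Q i k hk) as (a & _ & b & _).
        apply b. unfold x in e; rewrite <- e. exact (po_refl hpo a).
      * exists (x i); split; [exact hi | eauto].
Qed.

(** * Embedding the rationals by repeated splitting *)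

Section Dense.
Context (good : N -> Prop) (hgood : sets good) (c0 : N) (good_c0 : good c0)
  (good_split : forall d, good d -> exists x, piece d x /\
     good (child 0 d x) /\ good (child 1 d x)).

(* Every rational that has no value yet keeps a good piece in the position that
   its value should take relative to the values chosen so far. *)
Let reserve (s r d : N) : Prop := good d /\ forall p, p < len s ->
  (rlt p r -> forall y, piece d y -> strict L (ent s p) y) /\
  (rlt r p -> forall y, piece d y -> strict L y (ent s p)).
Let partial (s : N) : Prop :=
  (forall p, p < len s -> rational p -> P (ent s p)) /\
  (forall p q, p < len s -> q < len s -> rlt p q -> strict L (ent s p) (ent s q)) /\
  forall r, rational r -> len s <= r -> exists d, reserve s r d.

Lemma piece_0 d x y : piece (child 0 d x) y <-> piece d y /\ strict L y x.
Proof. apply piece_lt. Qed.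
Lemma piece_1 d x y : piece (child 1 d x) y <-> piece d y /\ strict L x y.
Proof. apply piece_gt. Qed.

Lemma reserve_skip s r d m : ~ rational (len s) -> reserve s r d -> reserve (app s m) r d.
Proof.
  intros n [h1 h2]; split; [exact h1|]. intros p hp.
  rewrite len_app in hp; apply lt_succ in hp; destruct hp as [hp | ->].
  - rewrite ent_app by exact hp; auto.
  - split; intros (a & b & _); tauto.
Qed.

(** A new rational n receives the splitting point x of the piece reserved for it. Another rational
    keeps its own reserve if an earlier value separates it from n, and otherwise takes over the half
    of the piece of n on its side of x. *)
Lemma partial_extend s : Seq s -> partial s -> exists m, partial (app s m).
Proof.
  intros hs (h1 & h2 & h3). set (n := len s).
  destruct (classic (rational n)) as [rn | rn].
  - destruct (h3 n rn (or_intror eq_refl)) as (d & gd & hd).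
    destruct (good_split gd) as (x & hx & g0 & g1).
    assert (forall p, p < n -> rlt p n -> strict L (ent s p) x) as lo
      by (intros p hp k; now apply (hd p hp)).
    assert (forall p, p < n -> rlt n p -> strict L x (ent s p)) as hi
      by (intros p hp k; now apply (hd p hp)).
    exists x; split; [|split].
    + intros p hp; rewrite len_app in hp; apply lt_succ in hp; destruct hp as [hp | ->].
      * rewrite ent_app by exact hp; auto.
      * intros _; rewrite ent_app_last; exact (piece_in hx).
    + intros p q hp hq hpq; rewrite len_app in hp, hq; apply lt_succ in hp, hq.
      destruct hp as [hp | ->], hq as [hq | ->].
      * rewrite !ent_app by auto; auto.
      * rewrite ent_app_last, ent_app by exact hp; auto.
      * rewrite ent_app_last, ent_app by exact hq; auto.
      * destruct (rlt_irrefl hpq).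
    + intros r hr l; rewrite len_app in l; fold n in l.
      assert (r <> n) as nr by (intros ->; ord).
      assert (forall d', good d' ->
        (forall p, p < n -> (rlt p r -> forall y, piece d' y -> strict L (ent s p) y) /\
          (rlt r p -> forall y, piece d' y -> strict L y (ent s p))) ->
        (rlt n r -> forall y, piece d' y -> strict L x y) ->
        (rlt r n -> forall y, piece d' y -> strict L y x) ->
        exists d', reserve (app s x) r d') as fin.
      { intros d' gd' k1 k2 k3; exists d'; split; [exact gd'|]. intros p hp.
        rewrite len_app in hp; apply lt_succ in hp; destruct hp as [hp | ->].
        - rewrite ent_app by exact hp; auto.
        - rewrite ent_app_last; auto. }
      destruct (h3 r hr) as (d' & gd' & hd'); [fold n; ord|].
      destruct (rlt_total rn hr) as [e | [lt | lt]]; [congruence | |].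
      * destruct (classic (exists p, p < n /\ rlt n p /\ rlt p r)) as [(p & a1 & a2 & a3) | no].
        -- apply (fin d' gd' hd').
           ++ intros _ y hy. apply (strict_trans hpo (hi p a1 a2)). now apply (hd' p a1).
           ++ intro k; destruct (rlt_asym lt k).
        (* No earlier rational lies between n and r, so d stands in the right position to all
           earlier values also for r, and its part above x respects the new value. *)
        -- apply (fin (child 1 d x) g1).
           ++ intros p hp; split; intros k y hy; apply piece_1 in hy; destruct hy as [hy _].
              ** apply (hd p hp); [|exact hy].
                 destruct k as (rp & k).
                 destruct (rlt_total rn rp) as [e | [u | u]]; [exfalso; ord | | exact u].
                 destruct no; exists p; unfold rlt; auto.
              ** apply (hd p hp); [exact (rlt_trans lt k) | exact hy].
           ++ intros _ y hy; now apply piece_1 in hy.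
           ++ intro k; destruct (rlt_asym lt k).
      * destruct (classic (exists p, p < n /\ rlt r p /\ rlt p n)) as [(p & a1 & a2 & a3) | no].
        -- apply (fin d' gd' hd').
           ++ intro k; destruct (rlt_asym lt k).
           ++ intros _ y hy. refine (strict_trans hpo _ (lo p a1 a3)). now apply (hd' p a1).
        -- apply (fin (child 0 d x) g0).
           ++ intros p hp; split; intros k y hy; apply piece_0 in hy; destruct hy as [hy _].
              ** apply (hd p hp); [exact (rlt_trans k lt) | exact hy].
              ** apply (hd p hp); [|exact hy].
                 destruct k as (_ & rp & k).
                 destruct (rlt_total rn rp) as [e | [u | u]]; [exfalso; ord | exact u |].
                 destruct no; exists p; unfold rlt; auto.
           ++ intro k; destruct (rlt_asym lt k).
           ++ intros _ y hy; now apply piece_0 in hy.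
  (* The position is not a rational; 0 is a filler on which no condition falls. *)
  - exists 0; split; [|split].
    + intros p hp; rewrite len_app in hp; apply lt_succ in hp; destruct hp as [hp | ->];
        [rewrite ent_app by exact hp; auto | tauto].
    + intros p q hp hq hpq; rewrite len_app in hp, hq; apply lt_succ in hp, hq.
      destruct hp as [hp | ->], hq as [hq | ->]; try (destruct hpq; tauto).
      rewrite !ent_app by auto; auto.
    + intros r hr l; rewrite len_app in l.
      destruct (h3 r hr) as [d hd]; [ord|]. exists d; now apply reserve_skip.
Qed.

Lemma embedding_of_dense : exists F, sets F /\ embedding rational rat_le P (coded L) F.
Proof.
  destruct (@path_exists M hM partial) as (f & hf & K).
  - unfold partial, reserve; defn.
  - unfold partial, reserve; rewrite len_emp. split; [|split].
    + intros p h; destruct (nlt0 h).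
    + intros p q h; destruct (nlt0 h).
    + intros r _ _; exists c0; split; [exact good_c0|]. intros p h; destruct (nlt0 h).
  - apply partial_extend.
  - assert (forall p, rational p -> P (f p)) as fP.
    { intros p hp. destruct (K (p + 1)) as [h _]. rewrite len_restr in h by auto.
      specialize (h p (lt_succ_diag p) hp). now rewrite ent_restr in h by auto using lt_succ_diag. }
    assert (forall p q, rlt p q -> strict L (f p) (f q)) as fS.
    { intros p q h. destruct (K (p + q + 1)) as (_ & k & _). rewrite len_restr in k by auto.
      assert (p < p + q + 1) as lp by (apply lt_succ, le_iff; eauto).
      assert (q < p + q + 1) as lq by (apply lt_succ, le_iff; exists p; apply addC).
      specialize (k p q lp lq h). now rewrite !ent_restr in k by auto. }
    exists (graph_on rational f); split; [apply sets_graph_on; [defn | exact hf]|].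
    split; [now apply is_function_graph_on|].
    intros p q y z hy hz; apply coded_graph_on in hy, hz.
    destruct hy as [hp ->], hz as [hq ->].
    rewrite rat_le_iff by auto. split.
    + intros [-> | h]; [apply (po_refl hpo), fP, hq | now apply fS].
    + intro h. destruct (rlt_total hp hq) as [e | [l | l]]; auto.
      apply fS in l; destruct l; tauto.
Qed.
End Dense.

(** If every member of B shrinks to a member incomparable with one of its points, an antichain
    results. Otherwise some c0 does not; then no member contained in c0 has an incomparable part in
    B, as this would be such a shrinking of c0, so each of them splits, and the members contained in
    c0 serve as the good pieces. *)
Lemma large_not_scattered_or_antichain :
  (exists A, sets A /\ antichain P L A /\ infinite A) \/
  exists F, sets F /\ embedding rational rat_le P (coded L) F.
Proof.
  destruct (classic (forall c, B c -> exists x c', piece c x /\ B c' /\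
    (forall y, piece c' y -> piece c y) /\ forall y, piece c' y -> perp L y x)) as [h | h].
  - left; now apply antichain_of_large.
  - right. apply not_all_ex_not in h; destruct h as [c0 h].
    apply imply_to_and in h; destruct h as [b0 h].
    apply (@embedding_of_dense (fun d => B d /\ forall y, piece d y -> piece c0 y)) with (c0 := c0).
    + defn.
    + auto.
    + intros d [bd hd]. destruct (der_cases (B_der bd)) as (x & hx & [k | [k1 k2]]).
      * destruct h; exists x, (child (1 + 1) d x).
        split; [apply hd, hx|]. split; [exact k|].
        split; intros y hy; apply piece_perp in hy; [apply hd|]; apply hy.
      * exists x; split; [exact hx|]. split; (split; [assumption|]); intros y hy;
          apply hd; [apply piece_lt in hy | apply piece_gt in hy]; apply hy.
Qed.

End Large.

(** * Assembling the equivalences *)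

Section Main.
Context {M : L2_structure} {hM : model M}.
Notation N := (num M).

Lemma ATR_countably_many (P L : N -> Prop) : arith_transfinite_recursion M ->
  sets P -> sets L -> partial_order P L -> scattered P L -> no_infinite_antichain P L ->
  countably_many_initial_intervals P L.
Proof.
  intros hATR hP hL hpo hsc hna.
  destruct (classic (exists f, is_path (attempt P L) f)) as [[f hf] | no].
  - exfalso. destruct (attempt_path hf) as [h1 h2]. assert (DF1 f) as df by apply hf.
    destruct (@large_not_scattered_or_antichain M hM P L hP hL hpo
      (fun c => f c <> zero)) as [k | k]; auto.
    defn.
  - exact (countably_many_of_no_path hP hL hATR no).
Qed.

Lemma linear_no_infinite_antichain (P L : N -> Prop) :
  linear_order P L -> no_infinite_antichain P L.
Proof.
  intros [_ tot] (A & _ & [hA anti] & inf).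
  destruct (inf zero) as (x & _ & hx). destruct (inf x) as (y & hxy & hy).
  destruct (anti x y hx hy) as [a b].
  - intros ->; exact (lt_irrefl hxy).
  - destruct (tot x y); auto.
Qed.

Lemma scattered_linear_ATR :
  (forall P L : N -> Prop, sets P -> sets L -> linear_order P L -> scattered P L ->
     countably_many_initial_intervals P L) -> arith_transfinite_recursion M.
Proof.
  intros h p e E hE W hW L hL hwo. exact (hierarchy_exists p e hE hW hL hwo h).
Qed.

End Main.

Unset Implicit Arguments.

Theorem theorem4p8 (M : L2_structure) (hM : ACA0 M) :
  (ATR0 M <->
   (allset P in M, allset L in M,
      partial_order P L -> scattered P L -> no_infinite_antichain P L ->
      countably_many_initial_intervals P L)) /\
  (ATR0 M <->
   (allset P in M, allset L in M,
      linear_order P L -> scattered P L ->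
      countably_many_initial_intervals P L)).
Proof.
  destruct (classic (exists X : num M -> Prop, sets X)) as [hX | no].
  - pose (m := Model hM hX : model M).
    assert ((allset P in M, allset L in M, linear_order P L -> scattered P L ->
      countably_many_initial_intervals P L) -> ATR0 M) as back.
    { intro h; split; [exact hM|]. apply scattered_linear_ATR.
      intros P L hP hL; exact (h P hP L hL). }
    split; split.
    + intros [_ hA] P hP L hL; now apply ATR_countably_many.
    + intro h; apply back. intros P hP L hL hlin hsc.
      apply (h P hP L hL); auto; [apply hlin | now apply linear_no_infinite_antichain].
    + intros [_ hA] P hP L hL hlin hsc.
      apply ATR_countably_many; auto; [apply hlin | now apply linear_no_infinite_antichain].
    + exact back.
  (* A structure without sets satisfies all three statements vacuously; for transfinite recursion
     this is because its assignment of set parameters would supply a set. *)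
  - assert (forall X : num M -> Prop, ~ sets X) as none by (intros X h; apply no; eauto).
    assert (ATR0 M) as hA.
    { split; [exact hM|]. intros p e E hE; destruct (none (E O) (hE O)). }
    split; (split; [intros _ P hP; destruct (none P hP) | auto]).
Qed.
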